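(* For $i=1,2$ let $\mathcal{G}_i$ be a compactly generated minimal groupoid of germs over a Cantor space. Assume that their orbital growth functions satisfy $\beta_{\mathcal{G}_1}(n)\not\preceq\beta_{\mathcal{G}_2}(n)$. Then there is no non-trivial homomorphism $\mathsf{A}(\mathcal{G}_1)\to\mathsf{F}(\mathcal{G}_2)$.
   Context: Pseudogroups and germs. All spaces are Hausdorff; a Cantor space is a space homeomorphic to the Cantor set. A pseudogroup over a compact space $X$ is a collection of homeomorphisms $F\colon U\to V$ between open subsets of $X$ which contains the identity of every open subset of $X$ and is closed under composition (defined on the largest possible domain), inverses, and unions of arbitrary compatible families; a family $\{F_i\colon U_i\to V_i\}$ is compatible if $F_i,F_j$ agree on $U_i\cap U_j$ and $F_i^{-1},F_j^{-1}$ agree on $V_i\cap V_j$ for all $i,j$. The germ $[F]_x$ of $F\colon U\to V$ at $x\in U$ is the class of $(F,x)$, where $(F_1,x_1)\sim(F_2,x_2)$ if $x_1=x_2$ and $F_1,F_2$ coincide near $x_1$. A groupoid of germs over $X$ is the set $\mathcal{G}$ of all germs of elements of some pseudogroup; it determines the pseudogroup, denoted $\widetilde{\mathcal{G}}$. The orbit of $x$ is $\{F(x)\colon F\in\widetilde{\mathcal{G}},\ x\in \mathrm{dom}(F)\}$; $\mathcal{G}$ is minimal if all orbits are dense. $\mathsf{F}(\mathcal{G})$ is the group of elements of $\widetilde{\mathcal{G}}$ with domain and range equal to $X$. $\mathsf{A}(\mathcal{G})\le \mathsf{F}(\mathcal{G})$ is the subgroup generated by all 3-cycles, i.e. elements $g\in\mathsf{F}(\mathcal{G})$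 of order 3 for which there are disjoint clopen sets $U_1,U_2,U_3$ with $g(U_1)=U_2$, $g(U_2)=U_3$, $g(U_3)=U_1$ and $g$ the identity outside $U_1\cup U_2\cup U_3$. $\mathcal{G}$ (over a Cantor space) is compactly generated if there is a finite set $\mathcal{T}\subset\widetilde{\mathcal{G}}$ of homeomorphisms between clopen subsets of $X$ such that every germ in $\mathcal{G}$ is the germ of a finite product of elements of $\mathcal{T}\cup\mathcal{T}^{-1}$. The orbital graph $\Gamma_x(\mathcal{G},\mathcal{T})$ is the graph whose vertex set is the orbit of $x$, with an edge $(y,T(y))$ for every $T\in\mathcal{T}$ and every $y$ in the orbit in the domain of $T$. For functions $f,g\colon\mathbb{N}\to\mathbb{N}$, $f\preceq g$ means that there is $C>0$ with $f(n)\le Cg(Cn)$ for all $n$. For a graph $\Gamma$, $\overline{b}_\Gamma(n)=\sup_{v\in\Gamma}|B_\Gamma(v,n)|$, where $B_\Gamma(v,n)$ is the ball of radius $n$ around $v$. The orbital growth of $\mathcal{G}$ is $\beta_{\mathcal{G}}(n)=\max_{x\in X}\overline{b}_{\Gamma_x(\mathcal{G},\mathcal{T})}(n)$; up to the equivalence relation ''$f\preceq g\preceq f$'' it does not depend on $\mathcal{T}$. *)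

(* Defs.v *)
From mathcomp Require Import all_boot all_order finmap.
From mathcomp Require Import all_classical topology cantor.

Set Implicit Arguments.
Unset Strict Implicit.
Unset Printing Implicit Defensive.

Local Open Scope classical_set_scope.

(* [cantor_space] is the product space bool^nat. *)
Definition is_cantor (X : topologicalType) : Prop :=
  exists (f : X -> cantor_space) (g : cantor_space -> X),
    [/\ continuous f, continuous g, cancel f g & cancel g f].

(* A partial map is represented by its graph, so that it carries its domain
   [F.`1] and its range [F.`2], and equality of partial maps is [=]. *)
Definition partial_map (X : Type) : Type := set (X * X).

Definition pid (X : Type) (U : set X) : partial_map X :=
  [set xy | U xy.1 /\ xy.1 = xy.2].

(* "F after G", on the largest possible domain. *)
Definition pcomp (X : Type) (F G : partial_map X) : partial_map X := (F \; G)%relation.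

Definition pinv (X : Type) (F : partial_map X) : partial_map X := (F^-1)%relation.

Definition pimage (X : Type) (F : partial_map X) (A : set X) : set X :=
  [set y | exists2 x, A x & F (x, y)].

(* [f] and [g] are arbitrary extensions to X of the map and of its inverse. *)
Definition phomeo (X : topologicalType) (F : partial_map X) : Prop :=
  exists (U V : set X) (f g : X -> X),
    [/\ open U /\ open V,
        set_fun U V f /\ set_fun V U g,
        (forall x, U x -> g (f x) = x) /\ (forall y, V y -> f (g y) = y),
        {within U, continuous f} /\ {within V, continuous g}
      & F = [set xy | U xy.1 /\ xy.2 = f xy.1]].

(* For F = F' the two conditions hold automatically for graphs of injective
   maps, so quantifying over all pairs is harmless. *)
Definition compatible (X : Type) (D : set (partial_map X)) : Prop :=
  forall F F', D F -> D F' ->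
    (forall x y y', F (x, y) -> F' (x, y') -> y = y') /\
    (forall x x' y, F (x, y) -> F' (x', y) -> x = x').

Record is_pseudogroup (X : topologicalType) (P : set (partial_map X)) : Prop := {
  pseudogroup_homeo : forall F, P F -> phomeo F;
  pseudogroup_id : forall U, open U -> P (pid U);
  pseudogroup_comp : forall F F', P F -> P F' -> P (pcomp F F');
  pseudogroup_inv : forall F, P F -> P (pinv F);
  pseudogroup_union : forall D : set (partial_map X),
    D `<=` P -> compatible D -> P (\bigcup_(F in D) F) }.

(* The germ of F at x is the equivalence class of the pair (F, x). *)
Definition germ_type (X : Type) : Type := set (partial_map X * X).

Definition germ (X : topologicalType) (F : partial_map X) (x : X) : germ_type X :=
  [set p | [/\ phomeo p.1, p.1.`1 p.2, p.2 = x
    & \forall z \near x, forall y, p.1 (z, y) <-> F (z, y)]].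

Definition germs_of (X : topologicalType) (P : set (partial_map X)) :
    set (germ_type X) :=
  [set c | exists F x, [/\ P F, F.`1 x & c = germ F x]].

Definition groupoid_of_germs (X : topologicalType) (G : set (germ_type X)) :
    Prop :=
  exists2 P : set (partial_map X), is_pseudogroup P & G = germs_of P.

(* See [pseudogroup_of_germs_of] below. *)
Definition pseudogroup_of (X : topologicalType) (G : set (germ_type X)) :
    set (partial_map X) :=
  [set F | phomeo F /\ forall x, F.`1 x -> G (germ F x)].

Definition germ_orbit (X : topologicalType) (G : set (germ_type X)) (x : X) :
    set X :=
  [set y | exists2 F, pseudogroup_of G F & F (x, y)].

Definition minimal (X : topologicalType) (G : set (germ_type X)) : Prop :=
  forall x, dense (germ_orbit G x).

Definition full_group (X : topologicalType) (G : set (germ_type X)) :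
    set (partial_map X) :=
  [set F | [/\ pseudogroup_of G F, F.`1 = [set: X] & F.`2 = [set: X]]].

Definition three_cycle (X : topologicalType) (G : set (germ_type X)) :
    set (partial_map X) :=
  [set g | [/\ full_group G g,
    pcomp g (pcomp g g) = pid [set: X] /\ g <> pid [set: X]
  & exists U1 U2 U3 : set X,
    [/\ clopen U1 /\ clopen U2 /\ clopen U3,
        U1 `&` U2 = set0 /\ U1 `&` U3 = set0 /\ U2 `&` U3 = set0,
        pimage g U1 = U2 /\ pimage g U2 = U3 /\ pimage g U3 = U1
      & forall x, ~ (U1 `|` U2 `|` U3) x -> g (x, x)]]].

Definition is_subgroup (X : Type) (A H : set (partial_map X)) : Prop :=
  [/\ H `<=` A, H (pid [set: X]),
      forall F F', H F -> H F' -> H (pcomp F F')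
    & forall F, H F -> H (pinv F)].

Definition alternating_group (X : topologicalType) (G : set (germ_type X)) :
    set (partial_map X) :=
  smallest (is_subgroup (full_group G)) (three_cycle G).

(* Only the values of [phi] on A matter. *)
Definition group_hom (X Y : Type) (A : set (partial_map X)) (B : set (partial_map Y))
    (phi : partial_map X -> partial_map Y) : Prop :=
  (forall F, A F -> B (phi F)) /\
  (forall F F', A F -> A F' -> phi (pcomp F F') = pcomp (phi F) (phi F')).

Definition nontrivial_hom (X Y : Type) (A : set (partial_map X))
    (phi : partial_map X -> partial_map Y) : Prop :=
  exists2 F, A F & phi F <> pid [set: Y].

(* The empty product is the identity of X. *)
Definition pprod (X : Type) (s : seq (partial_map X)) : partial_map X :=
  foldr (@pcomp X) (pid [set: X]) s.

Definition generating_set (X : topologicalType) (G : set (germ_type X))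
    (T : set (partial_map X)) : Prop :=
  [/\ finite_set T,
      T `<=` pseudogroup_of G,
      forall F, T F -> clopen F.`1 /\ clopen F.`2
    & forall c, G c -> exists (s : seq (partial_map X)) (x : X),
      [/\ (forall F, F \in s -> T F \/ T (pinv F)),
          (pprod s).`1 x & c = germ (pprod s) x]].

Definition compactly_generated (X : topologicalType) (G : set (germ_type X)) :
    Prop :=
  exists T, generating_set G T.

Record graph (V : Type) := Graph {
  vertices : set V;
  edge : V -> V -> Prop }.

(* Loops and multiplicities of edges play no role for balls. *)
Definition orbital_graph (X : topologicalType) (G : set (germ_type X))
    (T : set (partial_map X)) (x : X) : graph X :=
  {| vertices := germ_orbit G x;
     edge := fun y z => germ_orbit G x y /\ exists2 F, T F & F (y, z) |}.

(* Ball for the path distance; the orientation of edges is ignored. *)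
Fixpoint graph_ball (V : Type) (Gamma : graph V) (v : V) (n : nat) : set V :=
  if n is m.+1 then
    graph_ball Gamma v m `|`
    [set w | exists2 u, graph_ball Gamma v m u
                      & edge Gamma u w \/ edge Gamma w u]
  else [set v].

(* [fset_set] and [supremum] return junk values on infinite and on unbounded
   sets respectively; by [card_ball_orbital_graph] below these do not occur
   for orbital graphs. *)
Definition graph_growth (V : choiceType) (Gamma : graph V) (n : nat) : nat :=
  supremum 0%N [set #|` fset_set (graph_ball Gamma v n)| | v in vertices Gamma].

Definition orbital_growth (X : topologicalType) (G : set (germ_type X))
    (T : set (partial_map X)) (n : nat) : nat :=
  supremum 0%N [set graph_growth (orbital_graph G T x) n | x in [set: X]].

Definition growth_le (f g : nat -> nat) : Prop :=
  exists2 C : nat, (0 < C)%N & forall n, (f n <= C * g (C * n))%N.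

Section Facts.
Variable X : topologicalType.
Implicit Types (F : partial_map X) (P : set (partial_map X)) (G : set (germ_type X)).

Lemma phomeo_fun F x y y' : phomeo F -> F (x, y) -> F (x, y') -> y = y'.
Proof. by case=> U [V [f [g [_ _ _ _ ->]]]] /= [_ ->] [_ ->]. Qed.

Lemma phomeo_inj F x x' y : phomeo F -> F (x, y) -> F (x', y) -> x = x'.
Proof.
case=> U [V [f [g [_ _ [fK _] _ ->]]]] /= [Ux ->] [Ux' E].
by rewrite -(fK _ Ux) E fK.
Qed.

Lemma phomeo_dom_open F : phomeo F -> open F.`1.
Proof.
case=> U [V [f [g [[oU _] _ _ _ ->]]]].
rewrite (_ : _.`1 = U)//; apply/seteqP; split=> x /=; first by case=> y [].
by move=> Ux; exists (f x).
Qed.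

(* A groupoid of germs determines its pseudogroup. *)
Lemma pseudogroup_of_germs_of P :
  is_pseudogroup P -> pseudogroup_of (germs_of P) = P.
Proof.
move=> pP; apply/seteqP; split=> F; last first.
  by move=> PF; split=> [|x Fx]; [exact: pseudogroup_homeo PF|exists F, x].
case=> hF gF.
pose D := [set H | P H /\ H `<=` F].
have -> : F = \bigcup_(H in D) H.
  apply/seteqP; split=> [[x y] Fxy|xy [H [_ HF] Hxy]]; last exact: HF.
  have Fx : F.`1 x by exists y.
  have [H [z [PH Hz E]]] := gF _ Fx.
  have : germ F x (F, x) by split=> //; apply: nearW.
  rewrite E => -[/= _ _ xz]; rewrite -{}xz in Hz *.
  rewrite /prop_near1 nbhsE => -[W [oW Wx] WFH].
  exists (pcomp H (pid W)); last first.
    by exists x => //; have [+ _] := WFH _ Wx y; exact.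
  split; first exact: (pseudogroup_comp pP PH (pseudogroup_id pP oW)).
  by move=> [a b] /= [c [/= Wa ac]]; rewrite -{c}ac => Hab; have [_] := WFH _ Wa b; exact.
apply: (pseudogroup_union pP) => [H []//|H H' [_ HF] [_ HF']]; split.
- by move=> x y y' /HF xy /HF' xy'; exact: phomeo_fun hF xy xy'.
- by move=> x x' y /HF xy /HF' xy'; exact: phomeo_inj hF xy xy'.
Qed.

(* All balls of a given radius in all orbital graphs are finite, of uniformly
   bounded cardinality. *)
Lemma card_ball_orbital_graph G (T : set (partial_map X)) n :
  finite_set T -> T `<=` pseudogroup_of G ->
  exists k : nat, forall x v,
    finite_set (graph_ball (orbital_graph G T x) v n) /\
    (#|` fset_set (graph_ball (orbital_graph G T x) v n)| <= k)%N.
Proof.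
move=> finT TG.
suff [k Hk] : exists k : nat, forall x v, exists2 s : seq X, (size s <= k)%N &
    graph_ball (orbital_graph G T x) v n `<=` [set` s].
  exists k => x v; have [s sk sub] := Hk x v.
  have fb := sub_finite_set sub (finite_seq s); split=> //.
  apply: leq_trans sk; apply: (leq_trans _ (size_undup s)).
  apply: uniq_leq_size => [|w]; first exact: fset_uniq.
  by rewrite in_fset_set// inE mem_undup => /sub.
have [t tT] : exists t : seq (partial_map X), T = [set` t] by exact/finite_seqP.
have tG : forall F, F \in t -> phomeo F.
  by move=> F Ft; have [] := TG F; first by rewrite tT.
have nb : forall u, exists2 s : seq X, (size s <= 2 * size t)%N &
    forall F w, F \in t -> F (u, w) \/ F (w, u) -> w \in s.
  move=> u; have {}tG := tG; elim: t tG {tT} => [|F t IH] tG; first by exists [::].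
  have [F' F't|s ss Hs] := IH; first by apply: tG; rewrite inE F't orbT.
  have hF : phomeo F by apply: tG; rewrite inE eqxx.
  pose s1 := if pselect (exists w, F (u, w)) is left e then [:: projT1 (cid e)] else [::].
  pose s2 := if pselect (exists w, F (w, u)) is left e then [:: projT1 (cid e)] else [::].
  exists (s1 ++ s2 ++ s).
    rewrite !size_cat addnA /= mulnS leq_add//.
    by rewrite /s1 /s2; case: pselect => ?; case: pselect => ?.
  move=> F' w; rewrite inE !mem_cat => /orP[/eqP->|F't] H; last first.
    by rewrite (Hs _ _ F't H) !orbT.
  case: H => Fuw.
    rewrite /s1; case: pselect => [e|[]]; last by exists w.
    by case: cid => w' /= ?; rewrite inE (phomeo_fun hF Fuw (y' := w'))// eqxx.
  rewrite orbCA /s2; case: pselect => [e|[]]; last by exists w.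
  by case: cid => w' /= ?; rewrite inE (phomeo_inj hF Fuw (x' := w'))// eqxx.
have {nb} [nbr nbrk nbrP] : exists2 nbr : X -> seq X,
    forall u, (size (nbr u) <= 2 * size t)%N &
    forall u F w, F \in t -> F (u, w) \/ F (w, u) -> w \in nbr u.
  exists (fun u => projT1 (cid2 (nb u))) => u; by case: cid2.
elim: n => [|n [k IH]].
  by exists 1%N => x v; exists [:: v] => // w /= ->; rewrite inE.
exists (k + k * (2 * size t))%N => x v; have [s sk sub] := IH x v.
exists (s ++ flatten [seq nbr u | u <- s]).
  rewrite size_cat leq_add// (leq_trans _ (leq_mul sk (leqnn _)))//.
  elim: (s) => //= a l IHl; rewrite size_cat mulSn leq_add//.
move=> w /= [/sub/= ws|[u /sub/= us uw]]; rewrite mem_cat; first by rewrite ws.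
apply/orP; right; apply/flatten_mapP; exists u => //.
by case: uw => -[_ [F]]; rewrite tT => Ft ?; apply: (nbrP u F) => //; [left|right].
Qed.

End Facts.

(* Main.v *)
From mathcomp Require Import all_boot all_fingroup all_solvable zify.
Set Implicit Arguments.
Unset Strict Implicit.
Unset Printing Implicit Defensive.

(** Let phi : A(G1) -> F(G2) be a non-trivial homomorphism; the growth of G1 is
then bounded by that of G2, for the following reason.

Every generator of G1 is, near each point of its domain, a product of two
3-cycles [germ_as_product]. By compactness finitely many 3-cycles suffice, and
their images under phi move points by a bounded amount in the orbital graphs of
G2 [displacement_bounded]. Hence the points of a ball of radius n around v, in
an orbital graph of G1, are of the form h_i v with h_i in A(G1) and phi(h_i)
moving points by at most C n [tame_ball]. It remains to find a point y for
which the phi(h_i) y are pairwise distinct: they all lie in the ball of radius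
C n around y. In other words, y has to be moved by phi(p) for every p among the
finitely many elements h_j^-1 h_i, with i <> j, and each of these moves v
[exists_displaced].

Let N be a neighbourhood of v that is disjoint from p(N) for all these p. By
minimality, N contains arbitrarily many disjoint small clopen pieces of the
same orbit, which are permuted by a subgroup L of A(G1) isomorphic to a large
alternating group. As Alt is simple, any 3-cycle of A(G1) that survives under
phi can be transported into N, so that L can be chosen with phi(L) non-trivial
[small_cycle3_moves]. The group L, supported in N, commutes with p L p^-1,
supported in p(N).

The rest is finite group theory [alternating_escape]. Let y be a point moved by
L and suppose that each point of its orbit L y is fixed by some p. Two points
of L y fixed by the same p have the same stabiliser in L, because L commutes
with p L p^-1 [stab_fixed]. So the stabiliser of y has at most as many
conjugates as there are elements p; since L is simple and much larger, the
stabiliser is normal, hence trivial. Then L acts freely on L y, and if p fixes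
z, u z, v z and v u z then u and v commute [fixed_commute]. Colouring a grid of
elements of L by the p that fix the corresponding points, the pigeonhole
principle provides such a configuration in which u and v do not commute, a
contradiction. *)

(** * Moving a point of an alternating orbit off given fixed-point sets *)

Section AlternatingEscape.
Local Open Scope group_scope.

(** The group G permutes the conjugates of H. If this action is faithful then G
embeds in the maps from a set with at most M elements to itself; otherwise its
kernel, the core of the normaliser of H, is G by simplicity, and H is normal. *)
Lemma simple_few_conjugates (gT : finGroupType) (G H : {group gT}) (M : nat) :
  simple G -> H \subset G -> #|H :^: G| <= M -> M ^ M < #|G| ->
  H :=: 1 \/ H :=: G.
Proof.
move=> /simpleP [ntG simG] sHG leM ltG.
have nK := gcore_normal (subsetIl G 'N(H)).
have [K1|KG] := simG _ nK; last first.
  apply: simG; rewrite /normal sHG.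
  have : G \subset 'N_G(H) by rewrite -{1}KG gcore_sub.
  by rewrite subsetI => /andP[].
pose act (g : gT) := [ffun X : {set gT} => if X \in H :^: G then X :^ g else set0].
have inj : {in G &, injective act}.
  move=> g g' Gg Gg' /ffunP E.
  suff : g * g'^-1 \in gcore 'N_G(H) G.
    by rewrite K1 => /set1P/eqP; rewrite -eq_mulgV1 => /eqP.
  apply/bigcapP => x Gx; rewrite mem_conjg.
  apply/setIP; split; first by rewrite groupJ ?groupM ?groupV.
  have := E (H :^ x); rewrite !ffunE imset_f// => HE.
  by apply/normP; rewrite conjgE invgK !conjsgM HE !conjsgK.
have : #|act @: G| <= #|pffun_on (set0 : {set gT}) (H :^: G) (H :^: G)|.
  apply: subset_leq_card; apply/subsetP => f /imsetP[k Gk ->].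
  apply/pffun_onP; split.
    by apply/subsetP => X; rewrite !inE ffunE; case: ifP => // _; rewrite eqxx.
  move=> X /imageP[Y HY ->]; rewrite ffunE HY.
  by case/imsetP: HY => h Gh ->; rewrite -conjsgM; apply: imset_f; rewrite groupM.
rewrite (card_in_imset inj) card_pffun_on => le.
suff : #|G| < #|G| by rewrite ltnn.
apply: leq_ltn_trans le _; apply: leq_ltn_trans ltG.
have [M0|] := posnP #|H :^: G|; first by rewrite M0 expn0 expn_gt0; case: (M).
move=> c0; apply: leq_trans (leq_pexp2l c0 leM) _.
by rewrite leq_exp2r// (leq_trans c0).
Qed.

(** The first term counts the pairs of rows together with a colour, and is
exceeded as [monochromatic_rectangle] requires; the two others make the
alternating group on [letters M] simple and of order larger than M ^ M. *)
Definition columns (M : nat) : nat := M.+1 * M.+1 * M + M ^ M + 5.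

(** Three letters used to correct parities and as a common pivot, then one
letter for each row and for each column of a grid. *)
Definition letters (M : nat) : finType := ('I_3 + ('I_M.+1 + 'I_(columns M)))%type.

Lemma card_letters M : 5 <= #|letters M| /\ M ^ M < #|'Alt_(letters M)|.
Proof.
have big : M ^ M + 5 <= #|letters M|.
  by rewrite !card_sum !card_ord /columns; lia.
split; first by apply: leq_trans big; rewrite leq_addl.
have := card_Alt (T := letters M); move: big; set m := #|letters M|.
case: m => [|[|[|[|m]]]] big; try lia.
move=> /(_ isT); rewrite factS => E.
have : 2 * (M ^ M + 5) <= 2 * #|'Alt_(letters M)|; last lia.
by rewrite E mulnC leq_mul// factS; have := fact_gt0 m.+2; lia.
Qed.

(** Each column has M + 1 cells, hence two of the same colour; there are more
columns than possible pairs of rows with a colour. *)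
Lemma monochromatic_rectangle (M : nat) (f : 'I_M.+1 -> 'I_(columns M) -> 'I_M) :
  exists i i' j j', [/\ i != i', j != j' &
     [/\ f i j = f i' j, f i j = f i j' & f i j = f i' j']].
Proof.
have pairP (j : 'I_(columns M)) : exists ii : 'I_M.+1 * 'I_M.+1,
    (ii.1 != ii.2) && (f ii.1 j == f ii.2 j).
  apply/existsP; apply: contraT; rewrite negb_exists => /forallP noeq.
  have : injective (f^~ j).
    move=> i i' E; apply/eqP; apply: contraT => ii'.
    by have := noeq (i, i'); rewrite /= ii' E eqxx.
  by move/leq_card; rewrite !card_ord ltnn.
pose ii j := xchoose (pairP j).
have iiP j : (ii j).1 != (ii j).2 /\ f (ii j).1 j = f (ii j).2 j.
  by have /andP[? /eqP] := xchooseP (pairP j).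
pose h j := (ii j, f (ii j).1 j).
have /injectivePn[j [j' jj' E]] : ~~ injectiveb h.
  apply/negP => /injectiveP/leq_card.
  by rewrite !card_prod !card_ord /columns; lia.
have [E1 E2] : ii j = ii j' /\ f (ii j).1 j = f (ii j').1 j' by case: E => -> ->.
have [d e] := iiP j; have [d' e'] := iiP j'.
exists (ii j).1, (ii j).2, j, j'; split=> //.
by rewrite -E1 in E2 e'; split=> //; rewrite E2.
Qed.

(** The maps [p i] stand for homeomorphisms that displace the supports of all
the permutations; [commute_conj] says that the conjugate of the permutation
group by [p i] commutes with the group. *)
Section Escape.
Variables (M : nat) (Y : eqType).
Notation T := (letters M).
Variable act : {perm T} -> Y -> Y.
Hypothesis act1 : act 1 =1 id.
Hypothesis actM : {in 'Alt_T &, forall s t y, act (s * t) y = act t (act s y)}.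
Variables p q : 'I_M -> Y -> Y.
Hypothesis pK : forall i, cancel (p i) (q i).
Hypothesis commute_conj : forall i, {in 'Alt_T &, forall s t y,
  p i (act t (q i (act s y))) = act s (p i (act t (q i y)))}.

Let stab y := [set s in 'Alt_T | act s y == y].

Lemma stab_group_set y : group_set (stab y).
Proof.
apply/group_setP; split; first by rewrite inE group1 act1 /=.
move=> s t /setIdP[As /eqP ys] /setIdP[At /eqP yt].
by rewrite inE groupM// actM// ys yt eqxx.
Qed.
Canonical stab_group y := Group (stab_group_set y).

Lemma stab_act y s : s \in 'Alt_T -> stab (act s y) = stab y :^ s.
Proof.
move=> As; apply/setP => t.
rewrite mem_conjg {1}/stab in_set [in RHS]in_set memJ_norm; last first.
  by rewrite (subsetP (normG _)) ?groupV.
apply: andb_id2l => At; rewrite conjgE invgK.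
rewrite !actM ?groupM ?groupV//.
apply/eqP/eqP => [->|E]; first by rewrite -actM ?groupV// mulgV act1.
by rewrite -[LHS]act1 -(mulVg s) actM ?groupV// E.
Qed.

(** At a fixed point of [p i], conjugation by [p i] turns the stabiliser in the
group into the stabiliser in the conjugate group, and the latter is constant on
orbits of the group since the two groups commute. *)
Lemma stab_fixed i y s : s \in 'Alt_T ->
  p i y = y -> p i (act s y) = act s y -> stab (act s y) = stab y.
Proof.
move=> As py psy; apply/esym/eqP; rewrite eqEcard {2}stab_act// cardJg leqnn andbT.
apply/subsetP => t /setIdP[At /eqP ty]; rewrite inE At /=.
apply/eqP; apply: (can_inj (pK i)).
have qy : q i y = y by rewrite -{1}py pK.
have qsy : q i (act s y) = act s y by rewrite -{1}psy pK.
by rewrite psy -{1}qsy commute_conj// qy ty py.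
Qed.

(** At a point whose image is fixed as well, a permutation and its conjugate by
[p i] act in the same way, and the conjugate of [s] commutes with [t]. *)
Lemma fixed_commute i y s t : s \in 'Alt_T -> t \in 'Alt_T ->
  p i y = y -> p i (act s y) = act s y -> p i (act t y) = act t y ->
  p i (act (t * s) y) = act (t * s) y -> act (t * s) y = act (s * t) y.
Proof.
move=> As At py psy pty.
have qy : q i y = y by rewrite -{1}py pK.
have qsy : q i (act s y) = act s y by rewrite -{1}psy pK.
have qty : q i (act t y) = act t y by rewrite -{1}pty pK.
rewrite actM// => <-.
by rewrite -{1}qty commute_conj// qy psy actM.
Qed.

(* The pivot [w] is the only letter moved by both families [a] and [b], apart
   from the transposition of [c] and [d], which makes these permutations even
   and cancels in quotients of two elements of the same family. *)
Let w : T := inl ord0.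
Let c : T := inl (inord 1).
Let d : T := inl (inord 2).
Let a (i : 'I_M.+1) : {perm T} := tperm w (inr (inl i)) * tperm c d.
Let b (j : 'I_(columns M)) : {perm T} := tperm w (inr (inr j)) * tperm c d.

Let cd : c != d. Proof. by rewrite /c /d /eq_op /= -val_eqE /= !inordK. Qed.

Lemma a_Alt i : a i \in 'Alt_T.
Proof. by rewrite Alt_even odd_permM !odd_tperm cd. Qed.

Lemma b_Alt j : b j \in 'Alt_T.
Proof. by rewrite Alt_even odd_permM !odd_tperm cd. Qed.

(** This says that a_i^-1 a_i' does not commute with the conjugate by a_i of
b_j^-1 b_j'; the two sides send the letter of the column j' to the letters of
different rows. *)
Lemma ab_noncommute i i' j j' : i != i' -> j != j' ->
  b j' * a i' != b j * a i' * (a i)^-1 * (b j)^-1 * b j' * a i.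
Proof.
move=> ii' jj'.
have az k l : a k (inr (inr l)) = inr (inr l) by rewrite permM !tpermD.
have aVz k l : (a k)^-1 (inr (inr l)) = inr (inr l) by rewrite -{1}(az k l) permK.
have aw k : a k w = inr (inl k) by rewrite permM tpermL tpermD.
have bz : b j (inr (inr j')) = inr (inr j') by rewrite permM !tpermD//; case/eqP: jj'.
have bVz : (b j)^-1 (inr (inr j')) = inr (inr j') by rewrite -{1}bz permK.
have bz' : b j' (inr (inr j')) = w.
  by rewrite permM tpermR tpermD// /c /d /w /eq_op /= -val_eqE /= inordK.
have fix4 (s t u v : {perm T}) z : s z = z -> t z = z -> u z = z -> v z = z ->
  (s * t * u * v) z = z by rewrite !permM => -> -> -> ->.
apply/eqP => /permP/(_ (inr (inr j'))).
rewrite [LHS]permM bz' aw [RHS]permM [X in a i X]permM fix4// bz' aw.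
by case=> E; rewrite E eqxx in ii'.
Qed.

(** The stabiliser of y has at most M conjugates by [stab_fixed], hence is
trivial; a monochromatic rectangle then contradicts [ab_noncommute]. *)
Lemma alternating_escape y :
  (exists2 s, s \in 'Alt_T & act s y != y) ->
  exists2 s, s \in 'Alt_T & forall i, p i (act s y) != act s y.
Proof.
case=> s0 As0 s0y.
have [/exists_inP[s As /forallP]|] :=
    boolP [exists s in 'Alt_T, [forall i, p i (act s y) != act s y]].
  by exists s.
rewrite negb_exists_in => /forall_inP noesc; exfalso.
have colP (s : subg_of 'Alt_T) : exists i, p i (act (val s) y) == act (val s) y.
  have := noesc _ (valP s); rewrite negb_forall => /existsP[i /negPn ?].
  by exists i.
(* colour s by some p i that fixes the image of y by s *)
pose col s := xchoose (colP s).
have colE s : p (col s) (act (val s) y) = act (val s) y.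
  exact/eqP/(xchooseP (colP s)).
have [T5 AltM] := card_letters M.
have AltE (s t : {perm T}) : s \in 'Alt_T -> t \in 'Alt_T ->
    act t y = act (s^-1 * t) (act s y).
  by move=> As At; rewrite -actM ?groupM ?groupV// mulKVg.
have few : #|stab y :^: 'Alt_T| <= M.
  pose g i := if [pick s | col s == i] is Some s then stab y :^ val s else set0.
  have : stab y :^: 'Alt_T \subset [set g i | i in 'I_M].
    apply/subsetP => _ /imsetP[s As ->]; apply/imsetP; exists (col (subg _ s)) => //.
    rewrite /g; case: pickP => [t /eqP ts|/(_ (subg _ s))]; last by rewrite eqxx.
    have := colE (subg _ s); rewrite -ts subgK// => ps; have := colE t.
    have At := valP t; rewrite -!stab_act// => pt; rewrite (AltE s)// in pt *.
    by rewrite (stab_fixed _ ps pt)// groupM// groupV.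
  move/subset_leq_card/leq_trans; apply.
  by rewrite (leq_trans (leq_imset_card _ _))// card_ord.
have sub : stab y \subset 'Alt_T by apply/subsetP => s /setIdP[].
have [S1|SA] := simple_few_conjugates (simple_Alt5 T5) sub few AltM; last first.
  by have := As0; rewrite -SA => /setIdP[_]; rewrite (negPf s0y).
pose ba i j := subg 'Alt_T (b j * a i).
have baE i j : val (ba i j) = b j * a i by rewrite subgK// groupM ?a_Alt ?b_Alt.
have [i [i' [j [j' [ii' jj' [E1 E2 E3]]]]]] :=
   monochromatic_rectangle (fun i j => col (ba i j)).
have /eqP := ab_noncommute ii' jj'; apply.
have Aba k l : b l * a k \in 'Alt_T by rewrite groupM ?a_Alt ?b_Alt.
have free s t : s \in 'Alt_T -> t \in 'Alt_T -> act s y = act t y -> s = t.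
  move=> As At E; have : s * t^-1 \in stab y.
    apply/setIdP; rewrite groupM ?groupV// actM ?groupV// E.
    by rewrite -actM ?groupV// mulgV act1.
  by rewrite S1 => /set1P/eqP; rewrite -eq_mulgV1 => /eqP.
apply: free; first exact: Aba.
  exact: (groupM (groupM (groupM (groupM (Aba _ _) (groupVr (a_Alt _)))
    (groupVr (b_Alt _))) (b_Alt _)) (a_Alt _)).
pose z := act (b j * a i) y; pose k := col (ba i j).
have pz : p k z = z by have := colE (ba i j); rewrite baE.
have pz1 : p k (act (b j * a i') y) = act (b j * a i') y.
  by rewrite /k E1; have := colE (ba i' j); rewrite baE.
have pz2 : p k (act (b j' * a i) y) = act (b j' * a i) y.
  by rewrite /k E2; have := colE (ba i j'); rewrite baE.
have pz3 : p k (act (b j' * a i') y) = act (b j' * a i') y.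
  by rewrite /k E3; have := colE (ba i' j'); rewrite baE.
pose u := (b j * a i)^-1 * (b j * a i'); pose v := (b j * a i)^-1 * (b j' * a i).
have Au : u \in 'Alt_T by rewrite groupM ?groupV.
have Av : v \in 'Alt_T by rewrite groupM ?groupV.
have uE : act (b j * a i') y = act u z by rewrite -AltE.
have vE : act (b j' * a i) y = act v z by rewrite -AltE.
have vuE : act (b j' * a i') y = act (v * u) z.
  rewrite (AltE (b j * a i))//; congr (act _ z).
  have gE (A A' B B' : {perm T}) :
      (B * A)^-1 * (B' * A') = (B * A)^-1 * (B' * A) * ((B * A)^-1 * (B * A')).
    by rewrite !invMg !mulgA mulgK mulgKV.
  exact: gE.
have := fixed_commute Au Av pz.
rewrite -uE -vE -vuE => /(_ pz1 pz2 pz3) ->.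
have <- : act (b j * a i * (u * v)) y = act (u * v) z.
  exact: actM (Aba _ _) (groupM Au Av) y.
congr (act _ y).
have gE (A A' B B' : {perm T}) :
    B * A * ((B * A)^-1 * (B * A') * ((B * A)^-1 * (B' * A))) =
    B * A' * A^-1 * B^-1 * B' * A.
  by rewrite !invMg !mulgA mulgK mulgV mul1g.
exact: gE.
Qed.
End Escape.

End AlternatingEscape.

From mathcomp Require Import all_order finmap all_classical topology cantor.
Require Import Defs.
Local Open Scope classical_set_scope.

(** * Compact and Cantor spaces *)

(** The sets whose complement in K satisfies Q form a filter; if it were proper
it would cluster at a point of K, against local validity of Q there. *)
Lemma compact_induction (X : topologicalType) (K : set X) (Q : set X -> Prop) :
  compact K -> Q set0 -> (forall A B, Q A -> Q B -> Q (A `|` B)) ->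
  (forall A B, A `<=` B -> Q B -> Q A) ->
  (forall x, K x -> exists2 N, nbhs x N & Q N) -> Q K.
Proof.
move=> cK Q0 QU Qsub Qloc; apply: contrapT => nQK.
pose F : set_system X := [set A | Q (K `\` A)].
have FF : ProperFilter F.
  split; first by rewrite /F /= setD0.
  split; first by rewrite /F /= setDT.
    by move=> A B QA QB; rewrite /F /= setDIr; exact: QU.
  by move=> A B AB; apply: Qsub; exact: setDS.
have FK : F K by rewrite /F /= setDv.
have [x [Kx clx]] := cK F FF FK.
have [N xN QN] := Qloc x Kx.
have [|z [nNz Nz]] := clx (~` N) N _ xN; last exact: nNz Nz.
by rewrite /F /= setDE setCK; apply: Qsub QN => z [].
Qed.

Section Cantor.
Variables (X : topologicalType) (cantorX : is_cantor X).

Lemma is_cantor_compact : compact [set: X].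
Proof.
have [f [g [cf cg fK gK]]] := cantorX.
have -> : [set: X] = g @` [set: cantor_space].
  by apply/seteqP; split=> // x _; exists (f x).
by apply: continuous_compact cantor_space_compact; exact: continuous_subspaceT.
Qed.

Lemma is_cantor_hausdorff : hausdorff_space X.
Proof.
have [f [g [cf cg fK gK]]] := cantorX.
rewrite open_hausdorff => x y xy.
have := cantor_space_hausdorff; rewrite open_hausdorff => /(_ (f x) (f y)).
rewrite (can_eq fK) => /(_ xy) [[A B] /= [+ +] [oA oB]] => /set_mem Ax /set_mem By AB.
exists (f @^-1` A, f @^-1` B) => /=; first by rewrite !inE.
split; [exact: open_comp|exact: open_comp|].
by rewrite -preimage_setI; move/eqP: AB => ->; rewrite preimage_set0.
Qed.

Lemma is_cantor_clopen (x : X) (N : set X) : nbhs x N ->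
  exists W, [/\ clopen W, W x & W `<=` N].
Proof.
have [f [g [cf cg fK gK]]] := cantorX; move=> xN.
have := @zero_dimensional_cvg _ (f x) cantor_space_hausdorff
  cantor_zero_dimensional cantor_space_compact.
move=> /(_ (g @^-1` N)) [].
  by apply: cg; rewrite fK.
move=> D [Dx cD] DN; exists (f @^-1` D); split=> //; first exact: preimage_clopen.
by move=> z /DN /=; rewrite fK.
Qed.

Lemma is_cantor_not_isolated (x : X) : ~ open [set x].
Proof.
have [f [g [cf cg fK gK]]] := cantorX; move=> ox.
have /perfectTP/(_ (f x)) := cantor_perfect; apply.
have -> : [set f x] = g @^-1` [set x]; last by apply: open_comp.
apply/seteqP; split=> z /=; first by move=> ->; rewrite fK.
by move=> <-; rewrite gK.
Qed.

(** A singleton is closed and not open, so removing finitely many points leaves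
a nonempty open set. *)
Lemma is_cantor_open_avoid (N : set X) (l : seq X) : open N -> N !=set0 ->
  exists N', [/\ open N', N' !=set0, N' `<=` N & forall u, u \in l -> ~ N' u].
Proof.
move=> oN N0; elim: l => [|a l [N' [oN' N'0 N'N Nl]]].
  by exists N; split=> [|||u].
have aT1 : closed [set a].
  by apply: accessible_closed_set1; exact: hausdorff_accessible is_cantor_hausdorff.
exists (N' `\` [set a]); split.
- by rewrite setDE; apply: openI => //; exact: closed_openC.
- apply: contrapT => none; apply: (@is_cantor_not_isolated a).
  suff <- : N' = [set a] by [].
  have N'a : N' `<=` [set a].
    by move=> z N'z; apply: contrapT => za; apply: none; exists z.
  by case: N'0 => z /[dup] N'z /N'a za; apply/seteqP; split=> // _ ->; rewrite -za.
- by move=> z [/N'N].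
- by move=> u; rewrite inE => /orP[/eqP -> [_]|/Nl H [/H]]//; exact.
Qed.
End Cantor.

(** * Partial maps given by functions *)

Definition pgraph (X : Type) (f : X -> X) : partial_map X :=
  [set xy | xy.2 = f xy.1].

Definition pgraph_on (X : Type) (f : X -> X) (O : set X) : partial_map X :=
  [set xy | O xy.1 /\ xy.2 = f xy.1].

Section Pgraph.
Variable X : Type.
Implicit Types f g : X -> X.

Lemma pgraph_inj f g : pgraph f = pgraph g -> f = g.
Proof.
move=> E; apply/funext => x.
by have : pgraph f (x, f x) by []; rewrite E.
Qed.

Lemma pgraphE f x y : pgraph f (x, y) = (y = f x). Proof. by []. Qed.

Lemma pgraph_onE f O x y : pgraph_on f O (x, y) = (O x /\ y = f x).
Proof. by []. Qed.

Lemma pcomp_pgraph f g : pcomp (pgraph f) (pgraph g) = pgraph (f \o g).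
Proof.
apply/seteqP; split=> -[x z].
  by move=> [y]; rewrite !pgraphE /= => -> ->.
by rewrite pgraphE => ->; exists (g x).
Qed.

Lemma pinv_pgraph f g : cancel f g -> cancel g f -> pinv (pgraph f) = pgraph g.
Proof.
move=> fK gK; apply/seteqP; split=> -[x z]; rewrite pgraphE.
  by move=> xz; rewrite (_ : x = f z)// fK.
by move=> ->; rewrite /pinv /= pgraphE gK.
Qed.

Lemma pid_pgraph : pid [set: X] = pgraph id.
Proof. by apply/seteqP; split=> -[x z]; rewrite pgraphE; [case|move=> ->; split]. Qed.

Lemma pgraph_onT f : pgraph_on f [set: X] = pgraph f.
Proof.
by apply/seteqP; split=> -[x z]; rewrite pgraph_onE pgraphE; [case|split].
Qed.

End Pgraph.

Section Pseudogroup.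
Variables (X : topologicalType) (P : set (partial_map X)).
Hypothesis pP : is_pseudogroup P.
Notation G := (germs_of P).
Implicit Types (f g : X -> X) (F : partial_map X).

Lemma pgraph_on_sub f U W : open W -> W `<=` U ->
  P (pgraph_on f U) -> P (pgraph_on f W).
Proof.
move=> oW WU Pf.
have -> : pgraph_on f W = pcomp (pgraph_on f U) (pid W).
  apply/seteqP; split=> -[x z].
    by rewrite pgraph_onE => -[Wx ->]; exists x; split=> //=; exact: WU.
  by case=> y [/= Wx <-]; rewrite !pgraph_onE => -[_ ->].
by apply: (pseudogroup_comp pP) => //; exact: pseudogroup_id.
Qed.

Lemma pseudogroup_image_open f W :
  P (pgraph_on f W) -> open (f @` W).
Proof.
move=> Pf.
suff -> : f @` W = (pinv (pgraph_on f W)).`1.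
  by apply: phomeo_dom_open; apply: pseudogroup_homeo pP _ _; exact: pseudogroup_inv.
apply/seteqP; split=> z /=.
  by move=> [x Wx <-]; exists x.
by move=> [x [/= Wx ->]]; exists x.
Qed.

Lemma pseudogroup_preimage_open f U N : open N ->
  P (pgraph_on f U) -> open (U `&` f @^-1` N).
Proof.
move=> oN Pf.
suff -> : U `&` f @^-1` N = (pcomp (pid N) (pgraph_on f U)).`1.
  apply: phomeo_dom_open; apply: pseudogroup_homeo pP _ _.
  by apply: pseudogroup_comp => //; exact: pseudogroup_id.
apply/seteqP; split=> z /=.
  by move=> [Uz Nfz]; exists (f z), (f z).
by move=> [x [y [/= Uz ->] [/= Nf _]]].
Qed.

Lemma pseudogroup_continuous f U : P (pgraph_on f U) -> {within U, continuous f}.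
Proof.
move=> /(pseudogroup_homeo pP)[U' [V [f' [g [_ _ _ [cf _] E]]]]].
have UU' : U = U'.
  apply/seteqP; split=> x Ux.
    by have : pgraph_on f U (x, f x) by []; rewrite E => -[].
  by have [] : pgraph_on f U (x, f' x) by rewrite E; split.
rewrite UU'; apply: subspace_eq_continuous cf => x; rewrite inE => U'x.
by have [] : pgraph_on f U (x, f' x) by rewrite E; split.
Qed.

Lemma pseudogroup_injective f U x y :
  P (pgraph_on f U) -> U x -> U y -> f x = f y -> x = y.
Proof.
move=> /(pseudogroup_homeo pP) hf Ux Uy E.
by apply: (phomeo_inj hf (y := f x)).
Qed.

(** The graph of an injective function is the union of the elements of the
pseudogroup that it contains, and these form a compatible family. *)
Lemma pseudogroup_local f : injective f ->
  (forall x, exists H, [/\ P H, H.`1 x & H `<=` pgraph f]) -> P (pgraph f).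
Proof.
move=> injf loc; pose D := [set H | P H /\ H `<=` pgraph f].
have -> : pgraph f = \bigcup_(H in D) H.
  apply/seteqP; split=> [[x y]|xy [H [_ HF] Hxy]]; last exact: HF.
  rewrite pgraphE => ->; have [H [PH [z Hxz] Hf]] := loc x.
  by exists H => //; have := Hf _ Hxz; rewrite pgraphE => <-.
apply: (pseudogroup_union pP) => [H []//|H H' [_ HF] [_ HF']]; split.
- by move=> x y y' /HF; rewrite pgraphE => -> /HF'; rewrite pgraphE.
- by move=> x x' y /HF; rewrite pgraphE => -> /HF'; rewrite pgraphE => /injf.
Qed.

Lemma full_group_pgraph f g : cancel f g -> cancel g f -> P (pgraph f) ->
  full_group G (pgraph f).
Proof.
move=> fK gK Pf; split; first by rewrite pseudogroup_of_germs_of.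
- by apply/seteqP; split=> // x _; exists (f x).
- by apply/seteqP; split=> // y _; exists (g y); rewrite pgraphE gK.
Qed.

Lemma full_groupP F : full_group G F ->
  exists f g, [/\ F = pgraph f, P (pgraph f), cancel f g & cancel g f].
Proof.
case; rewrite pseudogroup_of_germs_of// => PF.
have [U [V [f [g [_ [fUV _] [fK gK] _ FE]]]]] := pseudogroup_homeo pP PF.
move=> dF rF.
have UT x : U x.
  have : F.`1 x by rewrite dF.
  by rewrite FE => -[y []].
have VT x : V x.
  have : F.`2 x by rewrite rF.
  by rewrite FE => -[z [/= Uz ->]]; exact: fUV.
have FfE : F = pgraph f.
  rewrite FE; apply/seteqP; split=> -[x z]; rewrite pgraphE; [by case|move=> ->].
  by split=> //=; exact: UT.
by exists f, g; rewrite -FfE; split=> // x; [exact: fK|exact: gK].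
Qed.

Lemma orbit_pgraph_on x u : germ_orbit G x u ->
  exists f U, [/\ open U, U x, f x = u & P (pgraph_on f U)].
Proof.
rewrite /germ_orbit pseudogroup_of_germs_of// => -[F PF Fxu].
have [U [V [f [g [[oU _] _ _ _ FE]]]]] := pseudogroup_homeo pP PF.
move: Fxu PF; rewrite FE => -[/= Ux ->] PF.
by exists f, U; split.
Qed.

End Pseudogroup.

(** * Permutations of disjoint pieces *)

Section Shuffle.
Variables (X : Type) (T : finType) (O : set X) (f : T -> X -> X).

Definition in_piece (z : X) (tx : T * X) : Prop := O tx.2 /\ f tx.1 tx.2 = z.

Definition disjoint_pieces : Prop := forall s t x y,
  O x -> O y -> f s x = f t y -> s = t /\ x = y.

(** The sets [f t @` O] are the pieces. When they are disjoint and the maps are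
injective on O, [shuffle s] carries the piece of index [t] onto the piece of
index [s t] through their common parametrisation by O, and is the identity
outside the pieces. *)
Definition shuffle (s : {perm T}) (z : X) : X :=
  if pselect (exists tx, in_piece z tx) is left e then
    let tx := projT1 (cid e) in f (s tx.1) tx.2
  else z.

Hypothesis disjf : disjoint_pieces.

Lemma shuffle_in s t x : O x -> shuffle s (f t x) = f (s t) x.
Proof.
move=> Ox; rewrite /shuffle; case: pselect => [e|[]]; last by exists (t, x).
by case: cid => -[t' x'] /= [Ox' /disjf[]//= -> ->].
Qed.

Lemma shuffle_out s z : (forall t x, O x -> z <> f t x) -> shuffle s z = z.
Proof.
move=> out; rewrite /shuffle; case: pselect => // -[[t x] [/= Ox E]].
by case: (out t x Ox).
Qed.

Lemma piece_cases z :
  (exists t x, O x /\ z = f t x) \/ (forall t x, O x -> z <> f t x).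
Proof.
have [[t [x [Ox ->]]]|no] := pselect (exists t x, O x /\ z = f t x).
  by left; exists t, x.
by right=> t x Ox E; apply: no; exists t, x.
Qed.

Lemma shuffle1 : shuffle 1%g = id.
Proof.
apply/funext => z; have [[t [x [Ox ->]]]|out] := piece_cases z.
  by rewrite shuffle_in// perm1.
exact: shuffle_out.
Qed.

Lemma shuffleM s t : shuffle (s * t)%g = shuffle t \o shuffle s.
Proof.
apply/funext => z /=; have [[a [x [Ox ->]]]|out] := piece_cases z.
  by rewrite !shuffle_in// permM.
by rewrite !(shuffle_out _ out).
Qed.

Lemma shuffleK s : cancel (shuffle s) (shuffle s^-1%g).
Proof.
move=> z; have := shuffleM s s^-1%g; rewrite mulgV shuffle1.
by move=> /(congr1 (fun h => h z)).
Qed.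

Lemma shuffleKV s : cancel (shuffle s^-1%g) (shuffle s).
Proof. by move=> z; have := shuffleK s^-1%g z; rewrite invgK. Qed.

End Shuffle.

(** Keeping only the pieces of index in the image of [j] does not change a
permutation that is supported by these indices. *)
Lemma shuffle_reindex (X : Type) (T T' : finType) (O : set X) (f : T' -> X -> X)
    (j : T -> T') (s : {perm T}) (s' : {perm T'}) :
  disjoint_pieces O f -> injective j ->
  (forall t, s' (j t) = j (s t)) -> (forall t', t' \notin codom j -> s' t' = t') ->
  shuffle O (f \o j) s = shuffle O f s'.
Proof.
move=> disjf injj sj s'out.
have disjfj : disjoint_pieces O (f \o j).
  by move=> a b x y Ox Oy /disjf[]// /injj.
apply/funext => z; have [[t' [x [Ox ->]]]|out] := piece_cases O f z.
  rewrite (shuffle_in disjf)//.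
  have [/codomP[t ->]|nt'] := boolP (t' \in codom j).
    by rewrite sj -[f (j t)]/((f \o j) t) shuffle_in.
  rewrite s'out// shuffle_out// => t y Oy /disjf[]// tt _.
  by rewrite tt codom_f in nt'.
by rewrite !shuffle_out// => t x Ox; exact: out.
Qed.

Lemma sub_disjoint_pieces (X : Type) (T : finType) (O W : set X) (f : T -> X -> X) :
  W `<=` O -> disjoint_pieces O f -> disjoint_pieces W f.
Proof. by move=> WO d s t x y /WO Ox /WO Oy; exact: d. Qed.

Lemma shuffle_setU (X : Type) (T : finType) (A B : set X) (f : T -> X -> X) s :
  disjoint_pieces (A `|` B) f -> A `&` B = set0 ->
  shuffle (A `|` B) f s = shuffle A f s \o shuffle B f s.
Proof.
move=> df AB0; have nAB x : A x -> B x -> False.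
  by move=> Ax Bx; have : (A `&` B) x by []; rewrite AB0.
have dA : disjoint_pieces A f by apply: sub_disjoint_pieces df => z; left.
have dB : disjoint_pieces B f by apply: sub_disjoint_pieces df => z; right.
apply/funext => z /=; have [[t [x [[Ax|Bx] ->]]]|out] := piece_cases (A `|` B) f z.
- rewrite (shuffle_in df); last by left.
  rewrite (@shuffle_out _ _ B) ?(shuffle_in dA)// => t' y By.
  by move=> /df[]; [left|right|move=> _ xy; apply: (nAB x) => //; rewrite xy].
- rewrite (shuffle_in df); last by right.
  rewrite (shuffle_in dB)// (@shuffle_out _ _ A)// => t' y Ay.
  by move=> /df[]; [right|left|move=> _ xy; apply: (nAB x) => //; rewrite xy].
- by rewrite (shuffle_out _ out) (@shuffle_out _ _ B) ?(@shuffle_out _ _ A)// => t x Ox;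
    apply: out; first [by left|by right].
Qed.

Lemma shuffle_set0 (X : Type) (T : finType) (f : T -> X -> X) s : shuffle set0 f s = id.
Proof. by apply/funext => z; exact: shuffle_out. Qed.

(** The supports of the two maps are contained in p(N) and in N. *)
Lemma shuffle_commute_conj (X : Type) (T : finType) (O N : set X) (f : T -> X -> X)
    (p q : X -> X) s t :
  disjoint_pieces O f -> (forall t x, O x -> N (f t x)) ->
  (forall x, N x -> ~ N (p x)) -> cancel p q -> cancel q p ->
  p \o shuffle O f t \o q \o shuffle O f s =
  shuffle O f s \o p \o shuffle O f t \o q.
Proof.
move=> df fN pN pK qK.
have inN u z : N z -> N (shuffle O f u z).
  move=> Nz; have [[a [x [Ox ->]]]|out] := piece_cases O f z.
    by rewrite shuffle_in//; exact: fN.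
  by rewrite shuffle_out.
have outN u z : ~ N z -> shuffle O f u z = z.
  by move=> nNz; apply: shuffle_out => a x Ox E; apply: nNz; rewrite E; exact: fN.
have conj_out u z : N z -> p (shuffle O f u (q z)) = z.
  move=> Nz; rewrite outN ?qK// => Nqz; by apply: (pN _ Nqz); rewrite qK.
apply/funext => z /=.
have [Nz|nNz] := pselect (N z).
  by rewrite !conj_out//; exact: inN.
rewrite (outN s z nNz).
have [Nqz|nNqz] := pselect (N (q z)).
  by rewrite (outN s)//; apply: pN; exact: inN.
by rewrite (outN t)// qK outN.
Qed.

(** The cycle that sends a to b, b to c and c to a, for distinct a, b, c. *)
Definition cycle3 (T : finType) (a b c : T) : {perm T} := (tperm a b * tperm a c)%g.

Section Cycle3.
Variables (T : finType) (a b c : T).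
Hypotheses (ab : a != b) (ac : a != c) (bc : b != c).

Lemma cycle3E1 : cycle3 a b c a = b.
Proof. by rewrite permM tpermL tpermD// eq_sym. Qed.
Lemma cycle3E2 : cycle3 a b c b = c.
Proof. by rewrite permM tpermR tpermL. Qed.
Lemma cycle3E3 : cycle3 a b c c = a.
Proof. by rewrite permM (tpermD ac bc) tpermR. Qed.
Lemma cycle3D z : z != a -> z != b -> z != c -> cycle3 a b c z = z.
Proof. by move=> za zb zc; rewrite permM !tpermD// eq_sym. Qed.

Lemma cycle3_cube : (cycle3 a b c * (cycle3 a b c * cycle3 a b c))%g = 1%g.
Proof.
apply/permP => z; rewrite permM [X in X = _]permM perm1.
have [->|za] := eqVneq z a; first by rewrite cycle3E1 cycle3E2 cycle3E3.
have [->|zb] := eqVneq z b; first by rewrite cycle3E2 cycle3E3 cycle3E1.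
have [->|zc] := eqVneq z c; first by rewrite cycle3E3 cycle3E1 cycle3E2.
by rewrite !cycle3D.
Qed.

Lemma cycle3_Alt : cycle3 a b c \in ('Alt_T)%g.
Proof. by rewrite Alt_even odd_permM !odd_tperm ab ac. Qed.
End Cycle3.

Lemma cycle3_inj (T T' : finType) (j : T -> T') a b c i : injective j ->
  cycle3 (j a) (j b) (j c) (j i) = j (cycle3 a b c i).
Proof. by move=> injj; rewrite !permM -!inj_tperm. Qed.

(** The 3-cycles generate a nontrivial normal subgroup of the simple group Alt. *)
Lemma Alt_sub_cycle3 (T : finType) (H : {set {perm T}}) : 5 <= #|T| ->
  group_set H -> (forall a b c, a != b -> a != c -> b != c -> cycle3 a b c \in H) ->
  ('Alt_T \subset H)%g.
Proof.
move=> T5 gH cycH.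
pose C := [set cycle3 x.1.1 x.1.2 x.2 | x in [set x : T * T * T |
  [&& x.1.1 != x.1.2, x.1.1 != x.2 & x.1.2 != x.2]]]%SET.
suff <- : <<C>>%g = ('Alt_T)%g.
  rewrite (gen_subG C (Group gH)); apply/fintype.subsetP => _ /imsetP[[[a b] c] + ->].
  by rewrite inE /= => /and3P[*]; exact: cycH.
have sC : (<<C>> \subset 'Alt_T)%g.
  rewrite gen_subG; apply/fintype.subsetP => _ /imsetP[[[a b] c] + ->].
  by rewrite inE /= => /and3P[*]; exact: cycle3_Alt.
have /simpleP[_ /(_ <<C>>%G)] := simple_Alt5 T5; case=> //=.
  rewrite /normal sC /= norms_gen//; apply/fintype.subsetP => s _.
  rewrite inE; apply/fintype.subsetP => _ /imsetP[_ /imsetP[[[a b] c] + ->] ->].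
  rewrite inE /= /cycle3 conjMg !tpermJ => /and3P[ab ac bc].
  by apply/imsetP; exists (s a, s b, s c); rewrite // inE /= !(inj_eq perm_inj) ab ac.
move=> C1; exfalso.
have /card_gt2P[a [b [c [_ [ab bc ca]]]]] : 2 < #|[set: T]%SET|.
  by rewrite cardsT; exact: leq_trans T5.
have : cycle3 a b c \in <<C>>%g.
  apply: mem_gen; apply/imsetP; exists (a, b, c) => //.
  by rewrite inE /= ab bc eq_sym ca.
rewrite C1 => /set1P/permP/(_ a); rewrite cycle3E1// perm1 => /esym/eqP.
by rewrite (negPf ab).
Qed.

(** * Elements of the alternating group of a pseudogroup *)

Lemma pimage_pgraph (X : Type) (f : X -> X) A : pimage (pgraph f) A = f @` A.
Proof.
apply/seteqP; split=> z /=.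
  by move=> [x Ax]; rewrite pgraphE => ->; exists x.
by move=> [x Ax <-]; exists x.
Qed.

Section AlternatingGroup.
Variables (X : topologicalType) (P : set (partial_map X)).
Hypothesis pP : is_pseudogroup P.
Notation G := (germs_of P).

Definition alternating (f : X -> X) : Prop := alternating_group G (pgraph f).

Lemma alternating_full f : alternating f -> full_group G (pgraph f).
Proof.
apply; split; last by move=> F [].
split=> //.
- rewrite pid_pgraph; apply: (full_group_pgraph pP (g := id)) => //.
  by rewrite -pid_pgraph; apply: pseudogroup_id => //; exact: openT.
- move=> F F' /(full_groupP pP)[f1 [g1 [-> Pf1 fK gK]]].
  move=> /(full_groupP pP)[f2 [g2 [-> Pf2 fK2 gK2]]].
  rewrite pcomp_pgraph; apply: (full_group_pgraph pP (g := g2 \o g1)).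
  + exact: can_comp.
  + exact: can_comp.
  + by rewrite -pcomp_pgraph; exact: pseudogroup_comp.
- move=> _ /(full_groupP pP)[f1 [g1 [-> Pf1 fK gK]]].
  rewrite (pinv_pgraph fK gK); apply: (full_group_pgraph pP (g := f1)) => //.
  by rewrite -(pinv_pgraph fK gK); exact: pseudogroup_inv.
Qed.

Lemma alternating_id : alternating id.
Proof. by rewrite /alternating -pid_pgraph => H [[]]. Qed.

Lemma alternating_comp f g : alternating f -> alternating g -> alternating (f \o g).
Proof.
move=> Af Ag; rewrite /alternating -pcomp_pgraph => H [sH cH].
by have [_ _ HM _] := sH; apply: HM; [exact: Af|exact: Ag].
Qed.

Lemma alternating_inv f : alternating f ->
  exists g, [/\ alternating g, cancel f g & cancel g f].
Proof.
move=> Af; have := full_groupP pP (alternating_full Af).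
move=> [f' [g [/pgraph_inj <- Pf fK gK]]].
exists g; split=> //; rewrite /alternating -(pinv_pgraph fK gK) => H [sH cH].
by have [_ _ _ HV] := sH; apply: HV; exact: Af.
Qed.

End AlternatingGroup.

Section Multisection.
Variables (X : topologicalType) (P : set (partial_map X)).
Hypothesis pP : is_pseudogroup P.
Hypothesis cantorX : is_cantor X.
Notation G := (germs_of P).

Definition multisection (T : finType) (O : set X) (f : T -> X -> X) : Prop :=
  [/\ clopen O, forall t, P (pgraph_on (f t) O) & disjoint_pieces O f].

Lemma sub_multisection (T : finType) (O W : set X) (f : T -> X -> X) :
  clopen W -> W `<=` O -> multisection O f -> multisection W f.
Proof.
move=> [oW clW] WO [_ Pf df]; split=> //.
  by move=> t; apply: (pgraph_on_sub pP oW WO).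
exact: sub_disjoint_pieces df.
Qed.

(** The finitely many distinct points [f t x] have disjoint neighbourhoods. *)
Lemma germ_multisection (T : finType) (f : T -> X -> X) (D : T -> set X) x N :
  (forall t, [/\ open (D t), D t x & P (pgraph_on (f t) (D t))]) ->
  injective (f^~ x) -> nbhs x N ->
  exists O, [/\ multisection O f, O x & O `<=` N].
Proof.
move=> fD finj xN.
have sep (st : T * T) : exists2 A : set X, nbhs x A &
    st.1 != st.2 -> forall u v, A u -> A v -> f st.1 u <> f st.2 v.
  case: st => s t /=; have [_|st] := eqVneq s t.
    by exists setT => //; exact: filterT.
  have := is_cantor_hausdorff cantorX; rewrite open_hausdorff => /(_ (f s x) (f t x)).
  rewrite (inj_eq finj) => /(_ st)[[A B] /= [/set_mem Ax /set_mem Bx] [oA oB AB]].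
  have [oDs Dsx Pfs] := fD s; have [oDt Dtx Pft] := fD t.
  exists ((D s `&` f s @^-1` A) `&` (D t `&` f t @^-1` B)).
    by apply: filterI; apply: open_nbhs_nbhs; split=> //;
      exact: (pseudogroup_preimage_open pP).
  move=> _ u v [[_ Au] _] [_ [_ Bv]] E.
  have : (A `&` B) (f s u) by split=> //; rewrite E.
  by rewrite (eqP AB).
pose A st := projT1 (cid2 (sep st)).
have xA st : nbhs x (A st) by rewrite /A; case: cid2.
have AP s t : s != t -> forall u v, A (s, t) u -> A (s, t) v -> f s u <> f t v.
  by rewrite /A; case: cid2 => /= B xB BP st; exact: BP.
have xD : \forall z \near x, forall t, D t z.
  by apply: filter_forall => t; apply: open_nbhs_nbhs; have [] := fD t.
have {}xA : \forall z \near x, forall st, A st z by exact: filter_forall.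
have [O [clO Ox ON]] := is_cantor_clopen cantorX (filterI xN (filterI xD xA)).
exists O; split=> //; last by move=> z /ON[].
split=> //.
  move=> t; have [oDt Dtx Pft] := fD t; apply: (pgraph_on_sub pP _ _ Pft).
    by case: clO.
  by move=> z /ON[_ [Dz _]]; exact: Dz.
move=> s t y z Oy Oz E; have [st|st] := eqVneq s t; last first.
  have [[_ [_ Ay]] [_ [_ Az]]] := (ON _ Oy, ON _ Oz).
  by case: (AP s t st y z (Ay _) (Az _) E).
subst t; split=> //; have [oDs Dsx Pfs] := fD s.
have [[_ [Dy _]] [_ [Dz _]]] := (ON _ Oy, ON _ Oz).
exact: (pseudogroup_injective pP Pfs (Dy s) (Dz s)).
Qed.

Section Shuffles.
Variables (T : finType) (O : set X) (f : T -> X -> X).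
Hypothesis msf : multisection O f.

Let df : disjoint_pieces O f. Proof. by case: msf. Qed.

Lemma piece_clopen t : clopen (f t @` O).
Proof.
have [clO Pf _] := msf; split; first exact: (pseudogroup_image_open pP (Pf t)).
apply: compact_closed; first exact: is_cantor_hausdorff.
apply: continuous_compact; first exact: (pseudogroup_continuous pP (Pf t)).
apply: (subclosed_compact _ (is_cantor_compact cantorX)) => //.
by case: clO.
Qed.

(** Locally, the map is a composition of transition maps between pieces, or the
identity on the open complement of all the pieces. *)
Lemma pseudogroup_shuffle s : P (pgraph (shuffle O f s)).
Proof.
have [clO Pf _] := msf.
apply: (pseudogroup_local pP); first exact: can_inj (shuffleK df s).
move=> z; have [[t [x [Ox ->]]]|out] := piece_cases O f z.
  exists (pcomp (pgraph_on (f (s t)) O) (pinv (pgraph_on (f t) O))); split.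
  - by apply: (pseudogroup_comp pP) => //; exact: pseudogroup_inv.
  - by exists (f (s t) x), x.
  - move=> [a b] [c [/= Oc ->] [/= _ ->]].
    by rewrite pgraphE shuffle_in.
have cU : closed (\bigcup_(t in [set: T]) (f t @` O)).
  by apply: closed_bigcup => [|t _]; [exact: finite_finset|case: (piece_clopen t)].
exists (pid (~` \bigcup_(t in [set: T]) (f t @` O))); split.
- by apply: pseudogroup_id => //; exact: closed_openC.
- by exists z; split=> //= -[t _ [x Ox E]]; exact: (out t x).
- move=> [a b] [/= na <-]; rewrite pgraphE shuffle_out// => t x Ox E.
  by apply: na; exists t => //; exists x.
Qed.

Lemma full_group_shuffle s : full_group G (pgraph (shuffle O f s)).
Proof.
exact: (full_group_pgraph pP (shuffleK df s) (shuffleKV df s) (pseudogroup_shuffle s)).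
Qed.

Lemma shuffle_piece s t : shuffle O f s @` (f t @` O) = f (s t) @` O.
Proof.
apply/seteqP; split=> z /=.
  by move=> [_ [x Ox <-] <-]; exists x => //; rewrite shuffle_in.
by move=> [x Ox <-]; exists (f t x); [exists x|rewrite shuffle_in].
Qed.

Lemma alternating_cycle3 a b c : a != b -> a != c -> b != c ->
  alternating P (shuffle O f (cycle3 a b c)).
Proof.
move=> ab ac bc; set s := cycle3 a b c.
have [O0|/set0P[x0 Ox0]] := eqVneq O set0.
  suff -> : shuffle O f s = id by exact: alternating_id.
  by apply/funext => z; apply: shuffle_out => t x; rewrite O0.
move=> H [_ cH]; apply: cH; split; first exact: full_group_shuffle.
  split.
    rewrite !pcomp_pgraph -!shuffleM// -mulgA cycle3_cube// shuffle1//.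
    by rewrite pid_pgraph.
  rewrite pid_pgraph => /pgraph_inj/(congr1 (fun h => h (f a x0))).
  rewrite shuffle_in// cycle3E1// => /df[]// E _.
  by rewrite E eqxx in ab.
have disj u v : u != v -> (f u @` O) `&` (f v @` O) = set0.
  move=> uv; apply/seteqP; split=> // z [[x Ox <-] [y Oy /df[]// E _]].
  by rewrite E eqxx in uv.
exists (f a @` O), (f b @` O), (f c @` O); split.
- by split; [|split]; exact: piece_clopen.
- by split; [|split]; exact: disj.
- by rewrite !pimage_pgraph !shuffle_piece cycle3E1// cycle3E2// cycle3E3.
- move=> z out; rewrite pgraphE.
  have [[t [x [Ox zE]]]|zout] := piece_cases O f z; last by rewrite shuffle_out.
  rewrite zE shuffle_in// cycle3D//; apply/eqP => E; apply: out; rewrite zE E.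
  + by left; left; exists x.
  + by left; right; exists x.
  + by right; exists x.
Qed.

Lemma alternating_shuffle s : 5 <= #|T| -> s \in ('Alt_T)%g ->
  alternating P (shuffle O f s).
Proof.
move=> T5; pose H := [set s | `[< alternating P (shuffle O f s) >]]%SET.
have HP u : reflect (alternating P (shuffle O f u)) (u \in H).
  by rewrite finset.in_set; exact: asboolP.
suff /fintype.subsetP sub : ('Alt_T \subset H)%g by move=> /sub/HP.
apply: (Alt_sub_cycle3 T5).
- apply/group_setP; split; first by apply/HP; rewrite shuffle1//; exact: alternating_id.
  by move=> u v /HP Au /HP Av; apply/HP; rewrite shuffleM//; exact: alternating_comp.
- by move=> a b c ab ac bc; apply/HP; exact: alternating_cycle3.
Qed.

End Shuffles.

Definition powers (h : X -> X) (i : 'I_3) : X -> X := iter i h.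
Definition rot3 : {perm 'I_3} := cycle3 ord0 (inord 1) (inord 2).

Lemma ord3_neq : [/\ (ord0 : 'I_3) != inord 1, (ord0 : 'I_3) != inord 2 &
  (inord 1 : 'I_3) != inord 2].
Proof. by split; rewrite -val_eqE /= !inordK. Qed.

Lemma ord3_cases (i : 'I_3) : [\/ i = ord0, i = inord 1 | i = inord 2].
Proof.
case: i => -[|[|[|//]]] p; [apply: Or31|apply: Or32|apply: Or33]; apply: val_inj => //=;
  by rewrite inordK.
Qed.

(** A 3-cycle is determined by its powers on the first of the three clopen sets.
Replacing this set by a smaller one gives the restrictions of the 3-cycle. *)
Lemma three_cycle_multisection h : three_cycle (germs_of P) (pgraph h) ->
  exists U, multisection U (powers h) /\ h = shuffle U (powers h) rot3.
Proof.
move=> [fh [h3 _] [U1 [U2 [U3 [[cU1 [cU2 cU3]] [U12 [U13 U23]] [h1 [h2 h31]] hout]]]]].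
rewrite !pimage_pgraph in h1 h2 h31.
have [_ [g [/pgraph_inj <- Ph hK gK]]] := full_groupP pP fh.
have Pid : P (pgraph id).
  by rewrite -pid_pgraph; apply: pseudogroup_id => //; exact: openT.
have Phh : P (pgraph (h \o h)) by rewrite -pcomp_pgraph; exact: pseudogroup_comp.
have h3E x : h (h (h x)) = x.
  move: h3; rewrite !pcomp_pgraph pid_pgraph => /pgraph_inj.
  by move=> /(congr1 (fun k => k x)).
have on (k : X -> X) : P (pgraph k) -> P (pgraph_on k U1).
  move=> Pk; apply: (pgraph_on_sub pP (U := setT)) => //; first by case: cU1.
  by rewrite pgraph_onT.
have in2 x : U1 x -> U2 (h x) by rewrite -h1 => Ux; exists x.
have in3 x : U2 x -> U3 (h x) by rewrite -h2 => Ux; exists x.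
have p0 : powers h ord0 = id by [].
have p1 : powers h (inord 1) = h by rewrite /powers inordK.
have p2 : powers h (inord 2) = h \o h by rewrite /powers inordK.
pose V (i : 'I_3) := match val i with 0 => U1 | 1 => U2 | _ => U3 end.
have pin x i : U1 x -> V i (powers h i x).
  move=> Ux; case: i => -[|[|[|//]]] p //=; rewrite /V /powers /=; first exact: in2.
  exact/in3/in2.
have Vdis i j x : V i x -> V j x -> i = j.
  have dis (A B : set X) : A `&` B = set0 -> A x -> B x -> False.
    by move=> AB Ax Bx; have : (A `&` B) x by []; rewrite AB.
  case: i j => -[|[|[|//]]] p [] [|[|[|//]]] p' /=; rewrite /V /= => Vi Vj;
    try (by apply/val_inj); exfalso;
    first [exact: (dis _ _ U12 Vi Vj)|exact: (dis _ _ U12 Vj Vi)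
          |exact: (dis _ _ U13 Vi Vj)|exact: (dis _ _ U13 Vj Vi)
          |exact: (dis _ _ U23 Vi Vj)|exact: (dis _ _ U23 Vj Vi)].
have pinj i x y : powers h i x = powers h i y -> x = y.
  by case: (ord3_cases i) => ->;
    rewrite ?p0 ?p1 ?p2//= => /(can_inj hK)// /(can_inj hK).
have dU1 : disjoint_pieces U1 (powers h).
  move=> i j x y Ux Uy E.
  suff ij : i = j by split=> //; rewrite -ij in E; exact: pinj E.
  by apply: (Vdis i j (powers h i x)); [exact: pin|rewrite E; exact: pin].
have ms : multisection U1 (powers h).
  split=> // i; apply: on.
  by case: (ord3_cases i) => ->; rewrite ?p0 ?p1 ?p2.
exists U1; split=> //; apply/funext => z.
have [n01 n02 n12] := ord3_neq.
have [[i [x [Ox ->]]]|out] := piece_cases U1 (powers h) z.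
  rewrite shuffle_in//; case: (ord3_cases i) => ->.
  - by rewrite cycle3E1 ?p0 ?p1.
  - by rewrite cycle3E2 ?p1 ?p2.
  - by rewrite cycle3E3 ?p0 ?p2//= h3E.
rewrite shuffle_out//; have := hout z; rewrite pgraphE => E; apply/esym/E.
case=> [[Uz|]|].
- by apply: (out ord0 z).
- by rewrite -h1 => -[x Ux E']; apply: (out (inord 1) x) => //; rewrite p1.
- by rewrite -h2 -h1 => -[_ [x Ux <-] E']; apply: (out (inord 2) x) => //; rewrite p2.
Qed.

Lemma displacing_neighbourhood (I : finType) (p : I -> X -> X) (v : X) :
  (forall i, P (pgraph (p i))) -> (forall i, p i v <> v) ->
  exists N, [/\ open N, N v & forall i x, N x -> ~ N (p i x)].
Proof.
move=> Pp pv.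
have loc i : exists A : set X, [/\ open A, A v & forall x, A x -> ~ A (p i x)].
  have := is_cantor_hausdorff cantorX; rewrite open_hausdorff => /(_ (p i v) v).
  have /eqP nv := pv i.
  move=> /(_ nv)[[A B] /= [/set_mem Ax /set_mem Bx] [oA oB /eqP AB]].
  exists (B `&` p i @^-1` A); split=> //.
    rewrite -[_ @^-1` _]setTI; apply: openI => //.
    apply: (pseudogroup_preimage_open pP oA).
    by rewrite pgraph_onT.
  move=> x [_ Ap] [Bp _]; have : (A `&` B) (p i x) by [].
  by rewrite AB.
pose A i := projT1 (cid (loc i)).
have AP i : [/\ open (A i), A i v & forall x, A i x -> ~ A i (p i x)].
  by rewrite /A; case: cid.
have vA : \forall z \near v, forall i, A i z.
  by apply: filter_forall => i; have [oA Av _] := AP i; exact: open_nbhs_nbhs.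
move: vA; rewrite /prop_near1 nbhsE => -[N [oN Nv] NA].
exists N; split=> // i x Nx Npx; have [_ _ H] := AP i.
exact: (H x (NA _ Nx i) (NA _ Npx i)).
Qed.

(** Orbits are dense and nonempty open sets are infinite. *)
Lemma orbit_points (T : finType) (x : X) (N : set X) (l : seq X) :
  minimal G -> open N -> N !=set0 ->
  exists u : T -> X, injective u /\
    forall t, [/\ N (u t), germ_orbit (germs_of P) x (u t) & u t \notin l].
Proof.
move=> minG oN N0.
have [us [sus uus usP]] : exists us : seq X, [/\ size us = #|T|, uniq us &
    forall u, u \in us -> [/\ N u, germ_orbit (germs_of P) x u & u \notin l]].
  elim: #|T| => [|k [us [sus uus usP]]]; first by exists [::].
  have [N' [oN' N'0 N'N avoid]] := is_cantor_open_avoid cantorX (us ++ l) oN N0.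
  have [u [N'u xu]] := minG x _ N'0 oN'.
  have := avoid u; rewrite mem_cat => nul.
  exists (u :: us); split; first by rewrite /= sus.
    by rewrite /= uus andbT; apply/negP => uu; apply: nul => //; rewrite uu.
  move=> v; rewrite inE => /orP[/eqP ->|/usP//]; split=> //; first exact: N'N.
  by apply/negP => uu; apply: nul => //; rewrite uu orbT.
exists (fun t => nth x us (enum_rank t)); split.
  by move=> s t /eqP; rewrite nth_uniq ?sus ?ltn_ord// => /eqP/val_inj/enum_rank_inj.
by move=> t; apply: usP; rewrite mem_nth// sus.
Qed.

End Multisection.

(** * Homomorphisms out of the alternating group *)

Section Hom.
Variables (X Y : topologicalType) (P : set (partial_map X)) (Q : set (partial_map Y)).
Hypotheses (pP : is_pseudogroup P) (pQ : is_pseudogroup Q).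
Variable phi : partial_map X -> partial_map Y.
Hypothesis homphi :
  group_hom (alternating_group (germs_of P)) (full_group (germs_of Q)) phi.

(** This is phi read on functions through [pgraph]; outside the alternating
group the value may be the default id. *)
Definition induced (h : X -> X) : Y -> Y :=
  if pselect (exists k, phi (pgraph h) = pgraph k) is left e then projT1 (cid e)
  else id.

Lemma induced_full h : alternating P h -> full_group (germs_of Q) (pgraph (induced h)).
Proof.
move=> Ah; rewrite /induced; have Bh := homphi.1 _ Ah.
case: pselect => [e|[]]; first by case: cid => k /= <-.
by have [f [_ [-> _ _ _]]] := full_groupP pQ Bh; exists f.
Qed.

Lemma inducedE h : alternating P h -> phi (pgraph h) = pgraph (induced h).
Proof.
move=> Ah; rewrite /induced; have Bh := homphi.1 _ Ah.
case: pselect => [e|[]]; first by case: cid => k /= <-.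
by have [f [_ [-> _ _ _]]] := full_groupP pQ Bh; exists f.
Qed.

Lemma induced_comp g h : alternating P g -> alternating P h ->
  induced (g \o h) = induced g \o induced h.
Proof.
move=> Ag Ah; apply: pgraph_inj.
rewrite -pcomp_pgraph -!inducedE//; last exact: alternating_comp.
by rewrite -pcomp_pgraph homphi.2.
Qed.

Lemma induced_id : induced id = id.
Proof.
have Ai := @alternating_id _ P.
have [f [g [/pgraph_inj E _ fK _]]] := full_groupP pQ (induced_full Ai).
apply/funext => y; apply: (can_inj fK); rewrite -E.
exact/esym/(congr1 (fun k => k y) (induced_comp Ai Ai)).
Qed.

Lemma inducedK g h : alternating P g -> alternating P h -> cancel g h ->
  cancel (induced g) (induced h).
Proof.
move=> Ag Ah gK y; have := induced_comp Ah Ag.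
have -> : h \o g = id by apply/funext.
by rewrite induced_id => /(congr1 (fun k => k y)).
Qed.

(** The 3-cycles generate the alternating group. *)
Lemma induced_moves_three_cycle :
  nontrivial_hom (alternating_group (germs_of P)) phi ->
  exists2 h, three_cycle (germs_of P) (pgraph h) & induced h <> id.
Proof.
case=> F AF nF; apply: contrapT => no; apply: nF.
have triv3 h : three_cycle (germs_of P) (pgraph h) -> induced h = id.
  by move=> th; apply: contrapT => nh; apply: no; exists h.
pose H := [set pgraph h | h in [set h | alternating P h /\ induced h = id]].
suff : H F by case=> h [Ah hid] <-; rewrite inducedE// hid pid_pgraph.
apply: AF; split; last first.
  move=> K tK; have [/(full_groupP pP)[h [_ [KE _ _ _]]] _ _] := tK.
  rewrite KE; exists h => //=; rewrite KE in tK; split; last exact: triv3.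
  by move=> H' [_ +]; exact.
split.
- by move=> _ [h [Ah _] <-]; exact: alternating_full.
- by exists id; [split; [exact: alternating_id|exact: induced_id]|rewrite pid_pgraph].
- move=> _ _ [g [Ag gid] <-] [h [Ah hid] <-]; exists (g \o h).
    by split; [exact: alternating_comp|rewrite induced_comp// gid hid].
  by rewrite pcomp_pgraph.
- move=> _ [g [Ag gid] <-]; have [h [Ah gK hK]] := alternating_inv pP Ag.
  exists h; last by rewrite (pinv_pgraph gK hK).
  split=> //; apply/funext => y.
  by have := inducedK Ag Ah gK y; rewrite gid.
Qed.

End Hom.

Section Displaced.
Variables (X Y : topologicalType) (P : set (partial_map X)) (Q : set (partial_map Y)).
Hypotheses (pP : is_pseudogroup P) (pQ : is_pseudogroup Q).
Hypotheses (cantorX : is_cantor X) (minP : minimal (germs_of P)).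
Variable phi : partial_map X -> partial_map Y.
Hypothesis homphi :
  group_hom (alternating_group (germs_of P)) (full_group (germs_of Q)) phi.
Hypothesis ntphi : nontrivial_hom (alternating_group (germs_of P)) phi.
Notation induced := (induced phi).

(** A shuffle over a disjoint union of clopen sets is the composition of the
shuffles over these sets, so if all small restrictions were in the kernel then,
by compactness, the whole shuffle would be. *)
Lemma cycle3_moves_locally (T : finType) (U : set X) (f : T -> X -> X) a b c :
  a != b -> a != c -> b != c -> multisection P U f ->
  induced (shuffle U f (cycle3 a b c)) <> id ->
  exists2 x, U x & forall O, clopen O -> O x ->
    exists W, [/\ clopen W, W `<=` O, W `<=` U &
      induced (shuffle W f (cycle3 a b c)) <> id].
Proof.
move=> ab ac bc msf moved; apply: contrapT => noloc; apply: moved.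
set s := cycle3 a b c in noloc *.
have [[oU clU] _ df] := msf.
pose good (A : set X) := exists V, [/\ clopen V, A `<=` V &
  forall W, clopen W -> W `<=` V -> W `<=` U -> induced (shuffle W f s) = id].
suff [V [_ UV]] : good U by apply.
apply: compact_induction.
- exact: subclosed_compact clU (is_cantor_compact cantorX) _.
- exists set0; split=> //; first exact: clopen0.
  by move=> W _; rewrite subset0 => -> _; rewrite shuffle_set0 (induced_id pQ homphi).
- move=> A B [V [cV AV HV]] [V' [cV' BV' HV']]; exists (V `|` V'); split.
  + exact: clopenU.
  + by move=> z [/AV|/BV']; [left|right].
  + move=> W cW WV WU; rewrite -(setUIDK W V).
    have [sI sD] : W `&` V `<=` W /\ W `\` V `<=` W by split=> z [].
    have [cI cD] : clopen (W `&` V) /\ clopen (W `\` V).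
      by split; [exact: clopenI|rewrite setDE; apply: clopenI => //; exact: clopenC].
    have msW : multisection P (W `&` V `|` W `\` V) f.
      by rewrite setUIDK; exact: sub_multisection msf.
    have IW : multisection P (W `&` V) f.
      by apply: (sub_multisection pP cI _ msf); exact: subset_trans WU.
    have DW : multisection P (W `\` V) f.
      by apply: (sub_multisection pP cD _ msf); exact: subset_trans WU.
    rewrite shuffle_setU//; last 2 first.
    - by case: msW.
    - by rewrite setDE setIACA setICr setI0.
    rewrite (induced_comp pQ homphi); [|exact: alternating_cycle3..].
    have -> : induced (shuffle (W `&` V) f s) = id.
      by apply: HV => //; exact: subset_trans WU.
    have -> // : induced (shuffle (W `\` V) f s) = id.
    apply: HV' => // [z [Wz Vz]|]; last exact: subset_trans WU.
    by case: (WV z Wz).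
- by move=> A B AB [V [cV BV HV]]; exists V; split=> //; exact: subset_trans BV.
- move=> x Ux; apply: contrapT => noN; apply: noloc; exists x => // O cO Ox.
  apply: contrapT => noW; apply: noN; exists O.
    by apply: open_nbhs_nbhs; split=> //; case: cO.
  exists O; split=> // W cW WO WU; apply: contrapT => nW; apply: noW.
  by exists W; split.
Qed.

(** The even permutations of the pieces that phi kills form a normal subgroup of
the simple group Alt: all the 3-cycles are killed or none is. *)
Lemma kernel_cycle3 (T : finType) (O : set X) (f : T -> X -> X) a b c a' b' c' :
  5 <= #|T| -> multisection P O f ->
  a != b -> a != c -> b != c -> a' != b' -> a' != c' -> b' != c' ->
  induced (shuffle O f (cycle3 a b c)) <> id ->
  induced (shuffle O f (cycle3 a' b' c')) <> id.
Proof.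
move=> T5 msf ab ac bc ab' ac' bc' moved fixed; apply: moved.
have df : disjoint_pieces O f by case: msf.
have altf s : (s \in 'Alt_T)%g -> alternating P (shuffle O f s).
  exact: alternating_shuffle.
pose K := [set s in ('Alt_T)%g | `[< induced (shuffle O f s) = id >]]%SET.
have KP s : reflect ((s \in 'Alt_T)%g /\ induced (shuffle O f s) = id) (s \in K).
  rewrite [_ \in K]finset.in_set.
  by apply: (iffP andP) => -[As ?]; split=> //; exact/asboolP.
have gK : group_set K.
  apply/group_setP; split.
    by apply/KP; rewrite group1 shuffle1// (induced_id pQ homphi).
  move=> s t /KP[As sid] /KP[At tid]; apply/KP; rewrite groupM//; split=> //.
  by rewrite shuffleM// (induced_comp pQ homphi) ?sid ?tid//; exact: altf.
have nK : (Group gK <| 'Alt_T)%g.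
  apply/normalP; split; first by apply/fintype.subsetP => s /KP[].
  move=> s As; apply/eqP; rewrite eqEcard cardJg leqnn andbT /=.
  apply/fintype.subsetP => _ /imsetP[t /KP[At tid] ->]; apply/KP.
  rewrite groupJ//; split=> //; rewrite conjgE !shuffleM//.
  have AV := altf s^-1%g; have {}At := altf _ At; have {}As' := altf _ As.
  rewrite groupV in AV; have {}AV := AV As.
  rewrite !(induced_comp pQ homphi)//; last exact: alternating_comp.
  rewrite tid; apply/funext => y /=.
  apply: (inducedK pQ homphi AV As') => z.
  by have := shuffleK df s^-1%g z; rewrite invgK.
have /simpleP[_ /(_ _ nK)[K1|KA]] := simple_Alt5 T5; last first.
  by have /KP[] : cycle3 a b c \in K by rewrite [K]KA cycle3_Alt.
have : cycle3 a' b' c' \in K by apply/KP; rewrite cycle3_Alt.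
rewrite [K]K1 => /set1P/permP/(_ a'); rewrite cycle3E1// perm1 => /esym/eqP.
by rewrite (negPf ab').
Qed.

(** Take a 3-cycle h that phi does not kill, and a point x near which its small
restrictions are not killed. Adding pieces around points of the orbit of x in N
to the three pieces of a small restriction of h, [kernel_cycle3] transports the
non-triviality to 3-cycles on the added pieces. *)
Lemma small_cycle3_moves (T : finType) (N : set X) (a b c : T) :
  open N -> N !=set0 -> 5 <= #|T| -> a != b -> a != c -> b != c ->
  exists O f, [/\ multisection P O f, forall t x, O x -> N (f t x) &
    induced (shuffle O f (cycle3 a b c)) <> id].
Proof.
move=> oN N0 T5 ab ac bc.
have [h th moved] := induced_moves_three_cycle pP pQ homphi ntphi.
have [U [msU hE]] := three_cycle_multisection pP th.
have [n01 n02 n12] := ord3_neq.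
rewrite hE in moved.
have [x Ux loc] := cycle3_moves_locally n01 n02 n12 msU moved.
have [u [uinj uP]] :=
  orbit_points cantorX T x [seq powers h i x | i <- enum 'I_3] minP oN N0.
have hu t : exists fD : (X -> X) * set X,
    [/\ open fD.2, fD.2 x, fD.1 x = u t & P (pgraph_on fD.1 fD.2)].
  have [_ /(orbit_pgraph_on pP)[f [D [oD Dx fx Pf]]] _] := uP t.
  by exists (f, D).
pose fu t := (projT1 (cid (hu t))).1; pose Du t := (projT1 (cid (hu t))).2.
have fuP t : [/\ open (Du t), Du t x, fu t x = u t & P (pgraph_on (fu t) (Du t))].
  by rewrite /fu /Du; case: cid.
pose f (i : 'I_3 + T) := match i with inl i => powers h i | inr t => fu t end.
pose D (i : 'I_3 + T) := match i with inl i => U | inr t => Du t end.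
have [[oU _] Ph dU] := msU.
have fD t : [/\ open (D t), D t x & P (pgraph_on (f t) (D t))].
  by case: t => [i|t] /=; [split|case: (fuP t)].
have finj : injective (f^~ x).
  have lr i t : powers h i x <> u t.
    move=> E; have [_ _ /negP] := uP t; apply; rewrite -E.
    by apply/mapP; exists i; rewrite // mem_enum.
  move=> [i|s] [j|t] //=.
  - by move=> /dU[]// ->.
  - by have [_ _ -> _] := fuP t => /lr.
  - by have [_ _ -> _] := fuP s => /esym/lr.
  - by have [_ _ -> _] := fuP s; have [_ _ -> _] := fuP t => /uinj ->.
have xN : \forall z \near x, forall t, (Du t `&` fu t @^-1` N) z.
  apply: filter_forall => t; apply: open_nbhs_nbhs; have [oD Dx fx Pf] := fuP t.
  split; first exact: (pseudogroup_preimage_open pP oN Pf).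
  by split=> //=; rewrite fx; have [] := uP t.
have [O [msO Ox ON]] := germ_multisection pP cantorX fD finj xN.
have clO : clopen O by case: msO.
have [W [clW WO WU Wmoved]] := loc O clO Ox.
have msW := sub_multisection pP clW WO msO.
exists W, (fun t => f (inr t)); split.
- by have [_ Pf dW] := msW; split=> // s t y z Wy Wz /dW[]// [->].
- by move=> t y Wy; have := ON _ (WO _ Wy) t; case.
have dW : disjoint_pieces W f by case: msW.
have inl_inj : injective (@inl 'I_3 T) by move=> i j [].
have inr_inj : injective (@inr 'I_3 T) by move=> i j [].
have T5' : 5 <= #|{: 'I_3 + T}| by rewrite card_sum (leq_trans T5)// leq_addl.
have E1 : shuffle W (powers h) rot3 =
    shuffle W f (cycle3 (inl ord0) (inl (inord 1)) (inl (inord 2))).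
  apply: (shuffle_reindex (j := inl) dW inl_inj); first by move=> i; exact: cycle3_inj.
  move=> [i|t] //=; first by rewrite codom_f.
  by move=> _; rewrite cycle3D.
have E2 : shuffle W (fun t => f (inr t)) (cycle3 a b c) =
    shuffle W f (cycle3 (inr a) (inr b) (inr c)).
  apply: (shuffle_reindex (j := inr) dW inr_inj); first by move=> i; exact: cycle3_inj.
  move=> [i|t] //=; last by rewrite codom_f.
  by move=> _; rewrite cycle3D.
rewrite E2; apply: (kernel_cycle3 T5' msW (a := inl ord0)
  (b := inl (inord 1)) (c := inl (inord 2))) => //.
by rewrite -E1.
Qed.

(** The alternating group of [small_cycle3_moves] inside a neighbourhood of v
displaced by all the [p i] meets the conditions of [alternating_escape]. *)
Lemma exists_displaced (M : nat) (p : 'I_M -> X -> X) (v : X) :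
  (forall i, alternating P (p i)) -> (forall i, p i v <> v) ->
  exists y, forall i, induced (p i) y <> y.
Proof.
move=> Ap pv.
have [q qP] : exists q : 'I_M -> X -> X, forall i,
    [/\ alternating P (q i), cancel (p i) (q i) & cancel (q i) (p i)].
  exists (fun i => projT1 (cid (alternating_inv pP (Ap i)))) => i.
  by case: cid.
have [N [oN Nv pN]] : exists N, [/\ open N, N v & forall i x, N x -> ~ N (p i x)].
  apply: (displacing_neighbourhood pP cantorX) => // i.
  by have [] := alternating_full pP (Ap i); rewrite pseudogroup_of_germs_of.
have [T5 _] := card_letters M.
have [n01 n02 n12] := ord3_neq.
pose a : letters M := inl ord0; pose b : letters M := inl (inord 1).
pose c : letters M := inl (inord 2).
have [ab ac bc] : [/\ a != b, a != c & b != c] by [].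
have [|O [f [msO fN moved]]] := small_cycle3_moves oN _ T5 ab ac bc.
  by exists v.
have [y ys] : exists y, induced (shuffle O f (cycle3 a b c)) y != y.
  apply: contrapT => no; apply: moved; apply/funext => y.
  by apply: contrapT => /eqP ys; apply: no; exists y.
have df : disjoint_pieces O f by case: msO.
have altf s : (s \in 'Alt_(letters M))%g -> alternating P (shuffle O f s).
  exact: alternating_shuffle.
have indpK i : cancel (induced (p i)) (induced (q i)).
  by have [Aq pK qK] := qP i; exact: (inducedK pQ homphi (Ap i) Aq).
have ind4 g1 g2 g3 g4 : alternating P g1 -> alternating P g2 -> alternating P g3 ->
    alternating P g4 -> induced (g1 \o g2 \o g3 \o g4) =
    induced g1 \o induced g2 \o induced g3 \o induced g4.
  move=> A1 A2 A3 A4; have A12 := alternating_comp A1 A2.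
  rewrite (induced_comp pQ homphi (alternating_comp A12 A3) A4).
  by rewrite (induced_comp pQ homphi A12 A3) (induced_comp pQ homphi A1 A2).
have [||i s t As At z||s As sP] := @alternating_escape M Y
  (fun s => induced (shuffle O f s)) _ _
  (fun i => induced (p i)) (fun i => induced (q i)) indpK _ y.
- by move=> z /=; rewrite shuffle1// (induced_id pQ homphi).
- by move=> s t As At z /=; rewrite shuffleM// (induced_comp pQ homphi)//; exact: altf.
- have [Aq pK qK] := qP i.
  have {As} As := altf s As; have {At} At := altf t At.
  have := shuffle_commute_conj s t df fN (pN i) pK qK.
  move/(congr1 (fun k => induced k z)).
  by rewrite (ind4 _ _ _ _ (Ap i) At Aq As) (ind4 _ _ _ _ As (Ap i) At Aq).
- by exists (cycle3 a b c) => //; exact: cycle3_Alt.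
- by exists (induced (shuffle O f s) y) => i; apply/eqP; exact: sP.
Qed.

End Displaced.

(** * Displacement and growth *)

Section Supremum.
Implicit Types A : set nat.

Lemma nat_supremumP A k : (forall a, A a -> a <= k) -> A !=set0 ->
  supremums A (supremum 0 A).
Proof.
move=> Ak /set0P A0; rewrite /supremum (negPf A0); apply: xgetPex.
by apply: nat_supremums_neq0; exists k => a Aa; rewrite leEnat; exact: Ak.
Qed.

Lemma nat_supremum_ub A k a : (forall b, A b -> b <= k) -> A a -> a <= supremum 0 A.
Proof.
move=> Ak Aa; have [+ _] := nat_supremumP Ak (ex_intro _ a Aa).
by move=> /(_ a Aa); rewrite leEnat.
Qed.

Lemma nat_supremum_le A k : (forall b, A b -> b <= k) -> supremum 0 A <= k.
Proof.
move=> Ak; have [->|/set0P A0] := eqVneq A set0; first by rewrite supremum0.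
have [_ +] := nat_supremumP Ak A0; move=> /(_ k); rewrite leEnat; apply.
by move=> a Aa; rewrite leEnat; exact: Ak.
Qed.
End Supremum.

Lemma sub_graph_ball (V : Type) (Gamma : graph V) v m n :
  m <= n -> graph_ball Gamma v m `<=` graph_ball Gamma v n.
Proof.
elim: n => [|n IH]; first by rewrite leqn0 => /eqP ->.
by rewrite leq_eqVlt => /orP[/eqP ->//|/IH mn z /mn]; left.
Qed.

Lemma graph_ball_trans (V : Type) (Gamma : graph V) u v w m n :
  graph_ball Gamma u m v -> graph_ball Gamma v n w -> graph_ball Gamma u (m + n) w.
Proof.
move=> uv; elim: n w => [|n IH] w; first by rewrite addn0 => /= ->.
rewrite addnS => -[/IH|[z /IH uz zw]]; first by left.
by right; exists z.
Qed.

Section Displacement.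
Variables (Y : topologicalType) (Q : set (partial_map Y)) (T : set (partial_map Y)).
Hypotheses (pQ : is_pseudogroup Q) (genT : generating_set (germs_of Q) T).
Hypothesis cY : compact [set: Y].
Notation G := (germs_of Q).
Notation Gamma := (orbital_graph G T).

(** The base point y0 only selects the orbital graph that contains y. *)
Definition displacement_le (c : nat) (k : Y -> Y) : Prop :=
  forall y0 y, germ_orbit G y0 y -> graph_ball (Gamma y0) y c (k y).

Lemma germ_orbit_refl y : germ_orbit G y y.
Proof.
rewrite /germ_orbit pseudogroup_of_germs_of//; exists (pid setT) => //.
by apply: pseudogroup_id => //; exact: openT.
Qed.

Lemma germ_orbit_step F y0 y z : Q F -> F (y, z) -> germ_orbit G y0 y ->
  germ_orbit G y0 z.
Proof.
rewrite /germ_orbit pseudogroup_of_germs_of// => QF Fyz [H QH Hy].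
by exists (pcomp F H); [exact: pseudogroup_comp|exists y].
Qed.

Lemma displacement_le_mono m n k : m <= n -> displacement_le m k -> displacement_le n k.
Proof. by move=> mn km y0 y /km; exact: sub_graph_ball. Qed.

Lemma displacement_le_comp m n k l : full_group G (pgraph l) ->
  displacement_le m k -> displacement_le n l -> displacement_le (n + m) (k \o l).
Proof.
case; rewrite pseudogroup_of_germs_of// => Ql _ _ km ln y0 y y0y.
by apply: graph_ball_trans (ln _ _ y0y) (km _ _ _); exact: germ_orbit_step Ql _ y0y.
Qed.

Lemma pprod_ball (s : seq (partial_map Y)) y0 y z :
  (forall F, F \in s -> T F \/ T (pinv F)) -> germ_orbit G y0 y ->
  pprod s (y, z) -> germ_orbit G y0 z /\ graph_ball (Gamma y0) y (size s) z.
Proof.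
have [_ TQ _ _] := genT; rewrite pseudogroup_of_germs_of// in TQ.
elim: s z => [|F s IH] z sT y0y; first by case=> /= _ <-.
case=> u su Fuz.
have [|y0u yu] := IH u _ y0y su.
  by move=> F' F's; apply: sT; rewrite inE F's orbT.
have TF := sT F (mem_head _ _).
have QF : Q F.
  case: TF => [/TQ//|/TQ QF]; suff <- : pinv (pinv F) = F by exact: pseudogroup_inv.
  by apply/seteqP; split=> -[a b].
have y0z : germ_orbit G y0 z by exact: germ_orbit_step QF Fuz y0u.
split=> //; right; exists u => //.
by case: TF => TF; [left; split=> //; exists F|right; split=> //; exists (pinv F)].
Qed.

(** Near each point k is a product of generators, of a length that is bounded by
compactness. *)
Lemma displacement_bounded k : Q (pgraph k) -> exists c, displacement_le c k.
Proof.
move=> Qk; have [_ _ _ germT] := genT.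
suff [c kc] : exists c, forall y0 y, [set: Y] y -> germ_orbit G y0 y ->
    graph_ball (Gamma y0) y c (k y) by exists c => y0 y; exact: kc.
pose good A := exists c, forall y0 y, A y -> germ_orbit G y0 y ->
    graph_ball (Gamma y0) y c (k y).
apply: (compact_induction (Q := good)) => //.
- by exists 0.
- move=> A B [c Ac] [d Bd]; exists (maxn c d) => y0 y [Ay|By] y0y.
    by apply: (sub_graph_ball (leq_maxl c d)); exact: Ac.
  by apply: (sub_graph_ball (leq_maxr c d)); exact: Bd.
- by move=> A B AB [c Bc]; exists c => y0 y /AB; exact: Bc.
- move=> y _; have hk := pseudogroup_homeo pQ Qk.
  have Gy : G (germ (pgraph k) y) by exists (pgraph k), y; split=> //; exists (k y).
  have [s [y' [sT _ E]]] := germT _ Gy.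
  have : germ (pgraph k) y (pgraph k, y) by split=> //; [exists (k y)|exact: nearW].
  rewrite E => -[/= _ _ <- near].
  exists [set z | pprod s (z, k z)].
    by apply: filterS near => z /(_ (k z))[+ _]; apply.
  exists (size s) => y0 z /= sz y0z.
  by have [] := pprod_ball sT y0z sz.
Qed.

Lemma card_ball_le_growth y n :
  #|` fset_set (graph_ball (Gamma y) y n)| <= orbital_growth G T n /\
  finite_set (graph_ball (Gamma y) y n).
Proof.
have [fT TG _ _] := genT; have [k kP] := card_ball_orbital_graph n fT TG.
split; last by have [] := kP y y.
have ub1 x a :
    [set #|` fset_set (graph_ball (Gamma x) v n)| | v in vertices (Gamma x)] a ->
    a <= k.
  by move=> [v _ <-]; have [] := kP x v.
apply: leq_trans (_ : graph_growth (Gamma y) n <= _).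
  by apply: (nat_supremum_ub (@ub1 y)); exists y => //; exact: germ_orbit_refl.
apply: (@nat_supremum_ub _ k); last by exists y.
by move=> _ [x _ <-]; apply: nat_supremum_le => a; exact: ub1.
Qed.

Lemma growth_le_bound n k :
  (forall x v, finite_set (graph_ball (Gamma x) v n) -> germ_orbit G x v ->
    #|` fset_set (graph_ball (Gamma x) v n)| <= k) ->
  orbital_growth G T n <= k.
Proof.
have [fT TG _ _] := genT; have [m mP] := card_ball_orbital_graph n fT TG.
move=> H; apply: nat_supremum_le => _ [x _ <-].
by apply: nat_supremum_le => _ [v xv <-]; apply: H => //; have [] := mP x v.
Qed.

End Displacement.

(** * Comparison of the growth functions *)

Section Growth.
Variables (X Y : topologicalType) (P : set (partial_map X)) (Q : set (partial_map Y)).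
Hypotheses (pP : is_pseudogroup P) (pQ : is_pseudogroup Q).
Hypotheses (cantorX : is_cantor X) (minP : minimal (germs_of P)).
Hypothesis compactY : compact [set: Y].
Variables (S : set (partial_map X)) (T : set (partial_map Y)).
Hypotheses (genS : generating_set (germs_of P) S)
  (genT : generating_set (germs_of Q) T).
Variable phi : partial_map X -> partial_map Y.
Hypothesis homphi :
  group_hom (alternating_group (germs_of P)) (full_group (germs_of Q)) phi.
Hypothesis ntphi : nontrivial_hom (alternating_group (germs_of P)) phi.
Notation induced := (induced phi).

Definition tame (c : nat) (h : X -> X) : Prop :=
  alternating P h /\ displacement_le Q T c (induced h).

Lemma tame_mono m n h : m <= n -> tame m h -> tame n h.
Proof. by move=> mn [Ah hm]; split=> //; exact: displacement_le_mono hm. Qed.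

Lemma tame_id : tame 0 id.
Proof. by split; [exact: alternating_id|rewrite (induced_id pQ homphi)]. Qed.

Lemma tame_comp m n g h : tame m g -> tame n h -> tame (n + m) (g \o h).
Proof.
move=> [Ag gm] [Ah hn]; split; first exact: alternating_comp.
rewrite (induced_comp pQ homphi)//; apply: displacement_le_comp => //.
exact: (induced_full pQ homphi).
Qed.

Lemma alternating_tame h : alternating P h -> exists c, tame c h.
Proof.
move=> Ah; have [] := induced_full pQ homphi Ah.
rewrite pseudogroup_of_germs_of// => Qh _ _.
by have [c hc] := displacement_bounded pQ genT compactY Qh; exists c.
Qed.

(** A 3-cycle that sends x to f(x) near x need not exist when f fixes x, so a
detour is made through another point k(x) of the orbit: first a 3-cycle that
extends k near x, then one that extends f k^-1 near k(x). *)
Lemma germ_as_product (f : X -> X) (U : set X) x : open U -> U x ->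
  P (pgraph_on f U) ->
  exists O s1 s2, [/\ nbhs x O, alternating P s1, alternating P s2 &
    forall z, O z -> s2 (s1 z) = f z].
Proof.
move=> oU Ux Pf.
have [u [uinj uP]] : exists u : bool -> X, injective u /\ forall b,
    [/\ setT (u b), germ_orbit (germs_of P) x (u b) & u b \notin [:: x; f x]].
  apply: orbit_points => //; first exact: openT.
  by exists x.
have hu b : exists kD : (X -> X) * set X,
    [/\ open kD.2, kD.2 x, kD.1 x = u b & P (pgraph_on kD.1 kD.2)].
  have [_ /(orbit_pgraph_on pP)[k [D [oD Dx kx Pk]]] _] := uP b.
  by exists (k, D).
pose k b := (projT1 (cid (hu b))).1; pose D b := (projT1 (cid (hu b))).2.
have kP b : [/\ open (D b), D b x, k b x = u b & P (pgraph_on (k b) (D b))].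
  by rewrite /k /D; case: cid.
have [kx kfx] : (forall b, k b x <> x) /\ (forall b, k b x <> f x).
  by split=> b; have [_ _ -> _] := kP b; have [_ _] := uP b;
    rewrite !inE negb_or => /andP[/eqP ? /eqP ?].
have kinj : injective (k^~ x).
  by move=> a b; have [_ _ -> _] := kP a; have [_ _ -> _] := kP b => /uinj.
have PidT : P (pgraph_on id setT).
  by rewrite pgraph_onT -pid_pgraph; apply: pseudogroup_id => //; exact: openT.
(* [k false] parametrises the third piece of both cycles *)
pose f1 (o : option bool) := if o is Some b then k b else id.
pose D1 (o : option bool) := if o is Some b then D b else setT.
pose f2 (o : option bool) := match o with
  None => k true | Some true => f | Some false => k false end.
pose D2 (o : option bool) := match o with
  None => D true | Some true => U | Some false => D false end.
have [|||O1 [ms1 O1x _]] := @germ_multisection _ _ pP cantorX _ f1 D1 x setT.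
- by move=> [b|]; [case: (kP b)|split=> //; exact: openT].
- move=> [a|] [b|] //= E; first by rewrite (kinj _ _ E).
    by case: (kx a).
  by case: (kx b).
- exact: filterT.
have nO1 : nbhs x O1 by have [[oO1 _] _ _] := ms1; exact: open_nbhs_nbhs.
have [||O2 [ms2 O2x O21]] :=
  @germ_multisection _ _ pP cantorX _ f2 D2 x O1 _ _ nO1.
- by move=> [[]|]; [split|case: (kP false)|case: (kP true)].
- move=> [[]|] [[]|] //= E; first [by case: (kfx true) | by case: (kfx false) | idtac].
    by have := kinj _ _ E.
  by have := kinj _ _ E.
have cO2 : clopen O2 by case: ms2.
have {}ms1 := sub_multisection pP cO2 O21 ms1.
pose s := cycle3 None (Some true) (Some false).
exists O2, (shuffle O2 f1 s), (shuffle O2 f2 s); split.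
- by apply: open_nbhs_nbhs; split=> //; case: cO2.
- exact: alternating_cycle3.
- exact: alternating_cycle3.
- have [_ _ d1] := ms1; have [_ _ d2] := ms2; move=> z Oz.
  have -> : shuffle O2 f1 s z = k true z.
    by rewrite -[z]/(f1 None z) shuffle_in// cycle3E1.
  by rewrite -[k true z]/(f2 None z) shuffle_in// cycle3E1.
Qed.

Lemma tame_step F : P F -> clopen F.`1 -> exists c, forall x z, F (x, z) ->
  exists2 g, tame c g & g x = z.
Proof.
move=> PF [oF clF].
suff [c cP] : exists c, forall x z, F.`1 x -> F (x, z) ->
    exists2 g, tame c g & g x = z.
  by exists c => x z Fxz; apply: cP => //; exists z.
pose good A := exists c, forall x z, A x -> F (x, z) ->
  exists2 g, tame c g & g x = z.
apply: (compact_induction (Q := good)).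
- exact: subclosed_compact clF (is_cantor_compact cantorX) _.
- by exists 0.
- move=> A B [c Ac] [d Bd]; exists (maxn c d) => x z [Ax|Bx] Fxz.
    have [g gc gx] := Ac x z Ax Fxz.
    by exists g => //; exact: tame_mono (leq_maxl _ _) gc.
  have [g gc gx] := Bd x z Bx Fxz.
  by exists g => //; exact: tame_mono (leq_maxr _ _) gc.
- by move=> A B AB [c Bc]; exists c => x z /AB; exact: Bc.
- have [U [V [f [_ [[oU _] _ _ _ FE]]]]] := pseudogroup_homeo pP PF.
  move=> x [z]; rewrite FE => -[/= Ux _].
  have Pf : P (pgraph_on f U) by rewrite FE in PF.
  have [O [s1 [s2 [xO A1 A2 sP]]]] := germ_as_product oU Ux Pf.
  have [c1 t1] := alternating_tame A1; have [c2 t2] := alternating_tame A2.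
  exists O => //; exists (c1 + c2) => y w Oy; rewrite FE => -[/= _ ->].
  by exists (s2 \o s1); [exact: tame_comp|exact: sP].
Qed.

Lemma tame_ball : exists2 c, 0 < c & forall n x v w,
  graph_ball (orbital_graph (germs_of P) S x) v n w ->
  exists2 g, tame (c * n) g & g v = w.
Proof.
have [fS SP Sclopen _] := genS; rewrite pseudogroup_of_germs_of// in SP.
have [c cS] : exists c, forall F, S F -> forall x z, F (x, z) \/ F (z, x) ->
    exists2 g, tame c g & g x = z.
  have [t St] := (finite_seqP _).1 fS.
  have : forall F, F \in t -> P F /\ clopen F.`1 /\ clopen F.`2.
    move=> F Ft; have SF : S F by rewrite St.
    by split; [exact: SP|exact: Sclopen].
  suff H : (forall F, F \in t -> P F /\ clopen F.`1 /\ clopen F.`2) ->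
    exists c, forall F, F \in t -> forall x z, F (x, z) \/ F (z, x) ->
    exists2 g, tame c g & g x = z.
    by move=> /H[c cP]; exists c => F; rewrite {1}St; exact: cP.
  elim: t {St} => [|F t IH] tP; first by exists 0.
  have [|c cP] := IH; first by move=> F' F't; apply: tP; rewrite inE F't orbT.
  have [PF [c1 c2]] := tP F (mem_head _ _).
  have [d dP] := tame_step PF c1.
  have [|e eP] := tame_step (pseudogroup_inv pP PF).
    suff -> : (pinv F).`1 = F.`2 by [].
    by apply/seteqP; split=> z [a]; exists a.
  exists (c + (d + e)) => F'; rewrite inE => /orP[/eqP ->|F't] x z.
    case=> [/dP|xz].
      move=> [g gd gx]; exists g => //.
      by apply: tame_mono gd; rewrite addnCA leq_addr.
    have [g gd gx] := eP x z xz.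
    by exists g => //; apply: tame_mono gd; rewrite addnA leq_addl.
  move=> /(cP F' F't)[g gc gx].
  by exists g => //; apply: tame_mono gc; rewrite leq_addr.
exists c.+1 => // n x v; elim: n => [|n IH] w.
  by move=> ->; exists id => //; rewrite muln0; exact: tame_id.
case=> [/IH[g gn gv]|[u /IH[g gn gv] uw]].
  by exists g => //; apply: tame_mono gn; rewrite leq_mul2l leqnSn orbT.
have [h hc hu] : exists2 h, tame c h & h u = w.
  by case: uw => -[_ [F SF Fuw]]; apply: (cS F SF); [left|right].
exists (h \o g); last by rewrite /= gv.
by apply: tame_mono (tame_comp hc gn); rewrite mulnSr leq_add2l leqnSn.
Qed.

(** The points of a ball are [h i v] with [h i] tame; a point y moved by the
image of each quotient of two distinct [h i] has as many images under them. *)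
Lemma growth_comparison : growth_le (orbital_growth (germs_of P) S)
  (orbital_growth (germs_of Q) T).
Proof.
have [c c0 cP] := tame_ball; exists c => // n.
apply: (leq_trans _ (leq_pmull _ c0)).
apply: (growth_le_bound genS) => x v finB _.
set B := graph_ball _ v n in finB *; pose N := #|` fset_set B|.
pose w (i : 'I_N) : X := nth v (fset_set B) i.
have wB i : B (w i).
  suff : w i \in fset_set B by rewrite in_fset_set// inE.
  exact: mem_nth.
have winj : injective w.
  by move=> i j /eqP; rewrite nth_uniq ?fset_uniq// => /eqP/val_inj.
have [h hP] : exists h : 'I_N -> X -> X, forall i, tame (c * n) (h i) /\ h i v = w i.
  exists (fun i => projT1 (cid2 (cP n x v (w i) (wB i)))) => i.
  by case: cid2.
have [h' h'P] : exists h' : 'I_N -> X -> X, forall i,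
    [/\ alternating P (h' i), cancel (h i) (h' i) & cancel (h' i) (h i)].
  exists (fun i => projT1 (cid (alternating_inv pP (hP i).1.1))) => i.
  by case: cid.
pose I := {ij : 'I_N * 'I_N | ij.1 != ij.2}.
(* the quotients are numbered, one for each pair of distinct indices *)
pose p (m : 'I_#|{: I}|) := let ij := val (enum_val m) in h' ij.2 \o h ij.1.
have [m|m|y yP] := @exists_displaced _ _ _ _ pP pQ cantorX minP _ homphi ntphi _ p v.
- apply: alternating_comp; first by case: (h'P (val (enum_val m)).2).
  by case: (hP (val (enum_val m)).1) => -[].
- rewrite /p /=; case: (enum_val m) => -[i j] /= ij.
  move=> /(congr1 (h j)); have [_ _ ->] := h'P j.
  rewrite (hP i).2 (hP j).2 => /winj E.
  by rewrite E eqxx in ij.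
have yinj : injective (fun i => induced (h i) y).
  move=> i j E; apply/eqP; apply: contraT => ij.
  have := yP (enum_rank (exist _ (i, j) ij : I)).
  rewrite /p enum_rankK /=; have [Ah' hK h'K] := h'P j.
  rewrite (induced_comp pQ homphi)//=; last by case: (hP i) => -[].
  by rewrite E (inducedK pQ homphi (hP j).1.1 Ah' hK).
have [le finB'] := card_ball_le_growth pQ genT y (c * n).
apply: leq_trans le; rewrite -[X in X <= _]/N.
have <- : size [seq induced (h i) y | i <- enum 'I_N] = N.
  by rewrite size_map size_enum_ord.
apply: uniq_leq_size; first by rewrite (map_inj_uniq yinj) enum_uniq.
move=> _ /mapP[i _ ->]; rewrite in_fset_set// inE.
by have [[_ +] _] := hP i; apply; exact: germ_orbit_refl.
Qed.

End Growth.

Theorem corollary1p16 (X1 X2 : topologicalType)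
  (cantor1 : is_cantor X1) (cantor2 : is_cantor X2)
  (G1 : set (germ_type X1)) (G2 : set (germ_type X2))
  (groupoid1 : groupoid_of_germs G1) (groupoid2 : groupoid_of_germs G2)
  (compact1 : compactly_generated G1) (compact2 : compactly_generated G2)
  (minimal1 : minimal G1) (minimal2 : minimal G2)
  (T1 : set (partial_map X1)) (T2 : set (partial_map X2))
  (gen1 : generating_set G1 T1) (gen2 : generating_set G2 T2)
  (growth : ~ growth_le (orbital_growth G1 T1) (orbital_growth G2 T2)) :
  ~ exists phi : partial_map X1 -> partial_map X2,
      group_hom (alternating_group G1) (full_group G2) phi /\
      nontrivial_hom (alternating_group G1) phi.
Proof.
move=> [phi [homphi ntphi]]; apply: growth.
have [P pP GP] := groupoid1; have [Q pQ GQ] := groupoid2.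
subst G1 G2.
exact: (growth_comparison pP pQ cantor1 minimal1 (is_cantor_compact cantor2)
  gen1 gen2 homphi ntphi).
Qed.
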